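(* There exist constants $C$ and $d_0$ such that for all integers $L$ and $d$ with $d \geq d_0$, every $\varepsilon$ with $d^{-1/2} \leq \varepsilon \leq 1/2$, every integer $n\ge 2$ and every even vertex $x$ of $G = G_n$, there exists a family $\mathcal{E}$ of subsets of $V(G)$ satisfying \[ |\mathcal{E}| \leq \exp\left( \frac{C\sqrt{\varepsilon}(\log d)^2}{d^{3/2}} L \right) \] and such that for every $\Gamma \in \mathrm{OMCut}(\varepsilon)$ with $|\Gamma| = L$, there is an $E \in \mathcal{E}$ that is an interior approximation to $\Gamma$.
   Context: $\mathbb{Z}^d$ carries its nearest-neighbor graph structure ($L^1$-distance $1$). A vertex is even (odd) if its coordinates sum to an even (odd) number. $G=G_n$ is the subgraph of $\mathbb{Z}^d$ induced on the lattice points in $[-n,n]^d$, and $B=B_n$ is the set of lattice points in $[-n,n]^d\setminus[-(n-1),n-1]^d$. $x$ is a fixed even vertex of $G$. $\log$ is the natural logarithm. $\mathrm{MCut}$ is the set of all minimal edge cutsets separating $x$ from $B$: sets $\Gamma\subseteq E(G)$ such that every path in $G$ from $x$ to $B$ uses an edge of $\Gamma$ and no strict subset of $\Gamma$ has this property. For $\Gamma\in\mathrm{MCut}$, $A_0(\Gamma)$ and $A_1(\Gamma)$ denote the connected components of $B$ and of $x$, respectively, in $G\setminus\Gamma$ (they partition $V(G)$); $P_\Gamma(v)$ is the number of edges of $\Gamma$ incident to $v$; and $E_1(\Gamma)=\{v\in A_1(\Gamma): P_\Gamma(v)>0\}$. $\mathrm{OMCut}$ (odd cutsets) is the set of $\Gamma\in\mathrm{MCut}$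 for which every vertex of $E_1(\Gamma)$ is odd. For $\Gamma\in\mathrm{OMCut}$: $E_{1,e}(\Gamma)=\{v\in E_1(\Gamma): P_\Gamma(v)\ge 2d-\sqrt d\}$; $\Gamma_r$ is the set of edges of $\Gamma$ whose endpoint in $E_1(\Gamma)$ lies in $E_1(\Gamma)\setminus E_{1,e}(\Gamma)$; and $\mathrm{OMCut}(\varepsilon)=\{\Gamma\in\mathrm{OMCut}: \varepsilon|\Gamma|<|\Gamma_r|\le 2\varepsilon|\Gamma|\}$. A set $E\subseteq V(G)$ is an interior approximation to $\Gamma$ if $E_1(\Gamma)\setminus E_{1,e}(\Gamma)\subseteq E\subseteq A_1(\Gamma)$. *)

(* Defs.v *)
From HB Require Import structures.
From mathcomp Require Import all_boot all_order all_algebra.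
From mathcomp Require Import reals sequences exp.

Set Implicit Arguments.
Unset Strict Implicit.
Unset Printing Implicit Defensive.

Import Order.TTheory GRing.Theory Num.Theory.

Local Open Scope ring_scope.

(* The lattice points of [-n, n]^d.  The ordinal k < 2n+1 in position i stands
   for the integer coordinate k - n; always read a vertex through [coordZ]. *)
Definition vertex (d n : nat) := {ffun 'I_d -> 'I_(n.*2.+1)}.

Section Cutsets.
Context {d n : nat}.
Implicit Types (u v x : vertex d n) (G : {set {set vertex d n}}).

Definition coordZ v (i : 'I_d) : int := (v i : nat)%:Z - n%:Z.

Definition even_vertex v : bool := (2 %| \sum_(i < d) coordZ v i)%Z.
Definition odd_vertex v : bool := ~~ even_vertex v.

Definition adj u v : bool := \sum_(i < d) `|coordZ u i - coordZ v i| == 1.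

Definition edges : {set {set vertex d n}} :=
  [set e | [exists u, exists v, adj u v && (e == [set u; v])]].

Definition boundary : {set vertex d n} :=
  [set v | ~~ [forall i, `|coordZ v i| <= n%:Z - 1]].

(* The edges traversed by the path x :: p. *)
Definition path_edges x (p : seq (vertex d n)) : seq {set vertex d n} :=
  pairmap (fun u v => [set u; v]) x p.

Definition separates G x : Prop :=
  forall p : seq (vertex d n),
    path adj x p -> uniq (x :: p) -> last x p \in boundary ->
    exists2 e, e \in path_edges x p & e \in G.

Definition MCut x G : Prop :=
  [/\ G \subset edges, separates G x &
      forall G' : {set {set vertex d n}}, G' \proper G -> ~ separates G' x].

Definition adj_minus G u v : bool := adj u v && ([set u; v] \notin G).

Definition A1 x G : {set vertex d n} := [set v | connect (adj_minus G) x v].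

Definition P G v : nat := #|[set e in G | v \in e]|.

Definition E1 x G : {set vertex d n} := [set v in A1 x G | (0 < P G v)%N].

Definition OMCut x G : Prop :=
  MCut x G /\ forall v, v \in E1 x G -> odd_vertex v.

Section RealParameters.
Context (R : realType).

Definition E1e x G : {set vertex d n} :=
  [set v in E1 x G | 2 * d%:R - Num.sqrt d%:R <= (P G v)%:R :> R].

Definition cut_r x G : {set {set vertex d n}} :=
  [set e in G | [exists v in E1 x G :\: E1e x G, v \in e]].

Definition OMCut_eps (eps : R) x G : Prop :=
  [/\ OMCut x G,
      eps * #|G|%:R < #|cut_r x G|%:R &
      #|cut_r x G|%:R <= 2 * eps * #|G|%:R].

Definition interior_approximation x G (E : {set vertex d n}) : Prop :=
  E1 x G :\: E1e x G \subset E /\ E \subset A1 x G.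

End RealParameters.
End Cutsets.

(* Main.v *)
(* Wrap the box in a discrete torus, so that every vertex has 2d neighbours, and
   let O be the even vertices outside A = A_1(Gamma) having a neighbour in A.
   The interior approximation is rebuilt from six small sets of vertices, all
   within distance 2 of O:
   - three sets recording, up to few errors, the even vertices that see about
     d^2 vertices of O at distance 2 (a random sample of O decides by majority);
   - odd vertices outside A chosen greedily, each seeing many new vertices of O
     almost surrounded by A, until no odd vertex outside A sees many of them;
   - a logarithmic-size cover of the rough vertices that see many exceptional
     even vertices;
   - one representative of each surviving component, after deletion of the even
     vertices marked by the previous sets and of the odd vertices most of whose
     neighbours are marked.
   A surviving component that starts inside A never leaves A except at vertices
   of O almost surrounded by A, so the odd vertices with many neighbours in the
   chosen components lie in A and, with the neighbours of the cover, contain all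
   rough vertices.  Isoperimetry in the torus bounds the number of components.
   Since O is connected at distance 2 (Timar), a net of O joins all these sets
   into one 18-step-connected set of size O(eps L log d / d^(3/2)); it is coded by
   a walk that starts on O within distance L of x, with O(log d) bits per step. *)

Require Import Defs.
From mathcomp Require Import all_boot all_order all_algebra.
From mathcomp Require Import boolp reals sequences exp.
From mathcomp Require Import zify ring lra.

Set Implicit Arguments.
Unset Strict Implicit.
Unset Printing Implicit Defensive.

Import Order.TTheory GRing.Theory Num.Theory.

(** * Greedy covers and spanning walks *)

(** For a cut edge from [v] in A to [u] outside A, the exits of [v] and the neighbours of [u] in A
    number at least 2d together. So a vertex of O with few vertices of O at distance 2 has almost
    none or almost all of its neighbours in A. The obstacle is the second kind ([pure]), through
    which a component could leak out of A. The greedy vertices outside A cure this: every odd vertex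
    outside A next to a pure one has three quarters of its neighbours marked, so it is deleted.
    Scales, with M = |Gamma_r|: each pure vertex has at least d rough neighbours, so there are at
    most M/d of them. A rough vertex has more than sqrt d neighbours in A, so h, about sqrt d / 2,
    serves as the threshold for recognising it; choices with gain h then cost M/(h d), of order eps
    L / d^(3/2). A component of more than d vertices has boundary about d^(3/2), which gives the
    same order for the representatives. Sample and net cost about L/d^2, up to a logarithm; eps >=
    d^(-1/2) makes this fit. Coding each point with O(log d) bits brings the second logarithm. *)

Lemma greedy_saturation (T U : finType) (cov : T -> {set U}) (C : {set T})
    (h : nat) (X : {set U}) : 0 < h ->
  exists S : {set T},
    [/\ S \subset C, #|S| * h <= #|X|,
        (forall s, s \in S -> cov s :&: X != set0) &
        forall t, t \in C -> #|cov t :&: X :\: \bigcup_(s in S) cov s| < h].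
Proof.
move=> h_gt0; move: {2}#|X|.+1 (ltnSn #|X|) => m.
elim: m X => // m IH X ltXm.
have [t /andP[tC ht]|noT] :=
    pickP [pred t | (t \in C) && (h <= #|cov t :&: X|)]; last first.
  exists set0; split => [||s|t tC]; rewrite ?sub0set ?cards0 ?inE //.
  rewrite big_set0 setD0 ltnNge; apply/negP => ht.
  by have /= := noT t; rewrite tC ht.
have cX : #|X| = #|cov t :&: X| + #|X :\: cov t| by rewrite setIC cardsID.
have [S [SC Sh Sne Ssat]] := IH (X :\: cov t) ltac:(lia).
exists (t |: S); split.
- by apply/subsetP => s /setU1P[->//|/(subsetP SC)].
- have : #|t |: S| <= #|S|.+1 by rewrite cardsU1; case: (t \in S).
  by nia.
- move=> s /setU1P[->|/Sne /set0Pn[x]].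
    by rewrite -card_gt0; lia.
  by rewrite !inE => /and3P[xs _ xX]; apply/set0Pn; exists x; rewrite !inE xs.
- move=> s /Ssat; apply: leq_ltn_trans; apply/subset_leq_card/subsetP => x.
  rewrite !inE => /and3P[xN xs ->].
  have [xt xS] : x \notin cov t /\ x \notin \bigcup_(s0 in S) cov s0.
    split; apply: contra xN => xin.
      by apply/bigcupP; exists t; rewrite ?setU11.
    have /bigcupP[s0 s0S xs0] := xin.
    by apply/bigcupP; exists s0; rewrite // setU1r.
  by rewrite xs xt xS.
Qed.

(** A maximal [r]-separated subset. For a connectivity relation it consists of one representative
    per component. *)
Lemma separated_net (T : finType) (r : rel T) (X : {set T}) :
    reflexive r -> symmetric r ->
  exists S : {set T},
    [/\ S \subset X, (forall x, x \in X -> exists2 s, s \in S & r s x) &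
        {in S &, forall s t, s != t -> ~~ r s t}].
Proof.
move=> rr rs; move: {2}#|X|.+1 (ltnSn #|X|) => m.
elim: m X => // m IH X ltXm.
have [->|[x xX]] := set_0Vmem X.
  by exists set0; split=> [|x|x y]; rewrite ?sub0set ?inE.
have [|S [SX Scov Ssep]] := IH (X :\: [set y | r x y]).
  apply: leq_trans (_ : #|X| <= m); last by [].
  rewrite -(cardsID [set y | r x y] X) -[X in X < _]add0n ltn_add2r.
  by apply/card_gt0P; exists x; rewrite !inE xX rr.
exists (x |: S); split.
- apply/subsetP => s /setU1P[->//|/(subsetP SX)].
  by rewrite !inE => /andP[].
- move=> y yX; have [rxy|nrxy] := boolP (r x y).
    by exists x; rewrite ?setU11.
  have [|s sS rsy] := Scov y; first by rewrite !inE nrxy yX.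
  by exists s; rewrite // setU1r.
- have xS s : s \in S -> ~~ r x s.
    by move=> /(subsetP SX); rewrite !inE => /andP[].
  move=> s t /setU1P[->|sS] /setU1P[->|tS] // nst; last exact: Ssep.
  + by rewrite eqxx in nst.
  + exact: xS.
  + by rewrite rs xS.
Qed.

(** Each round halves the largest possible gain. If all gains are below 2^(t+1), double counting
    gives |X| h <= |Z| 2^(t+1), so greedy choices of gain at least 2^t number at most 2|Z|/h. *)
Lemma logarithmic_cover (T U : finType) (cov : T -> {set U}) (Z : {set T})
    (h t : nat) (X : {set U}) : 0 < h ->
    (forall x, x \in X -> h <= #|[set z in Z | x \in cov z]|) ->
    (forall z, z \in Z -> #|cov z :&: X| < 2 ^ t) ->
  exists S : {set T},
    [/\ S \subset Z, #|S| * h <= 2 * t * #|Z|,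
        (forall s, s \in S -> cov s :&: X != set0) &
        X \subset \bigcup_(s in S) cov s].
Proof.
move=> h_gt0.
have dbl (Y : {set U}) :
    \sum_(x in Y) #|[set z in Z | x \in cov z]| = \sum_(z in Z) #|cov z :&: Y|.
  under eq_bigr => x _ do rewrite -sum1dep_card big_mkcondr.
  rewrite exchange_big /=; apply: eq_bigr => z _.
  by rewrite -sum1_card -big_mkcondr; apply: eq_bigl => x; rewrite !inE andbC.
elim: t X => [|t IH] X hX hZ.
  have X0 : X = set0.
    apply/eqP; rewrite -subset0; apply/subsetP => x xX.
    have := hX x xX; rewrite leqNgt => /negP[].
    suff -> : [set z in Z | x \in cov z] = set0 by rewrite cards0.
    apply/setP => z; rewrite !inE; apply/negP => /andP[zZ xz].
    have := hZ z zZ; rewrite ltnS leqn0 cards_eq0 => /eqP/setP/(_ x).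
    by rewrite !inE xz xX.
  by exists set0; rewrite X0 !sub0set cards0; split=> // s; rewrite inE.
have hXZ : #|X| * h <= #|Z| * 2 ^ t.+1.
  rewrite -!sum_nat_const; apply: leq_trans (_ : \sum_(x in X)
     #|[set z in Z | x \in cov z]| <= _); first by apply: leq_sum.
  by rewrite dbl; apply: leq_sum => z /hZ/ltnW.
have t_gt0 : 0 < 2 ^ t by rewrite expn_gt0.
have [S1 [S1Z S1h S1ne S1sat]] := greedy_saturation cov Z X t_gt0.
have [|z zZ|S2 [S2Z S2h S2ne S2cov]] :=
    IH (X :\: \bigcup_(s in S1) cov s).
- by move=> x /setDP[xX _]; apply: hX.
- apply: leq_ltn_trans (S1sat z zZ); apply/subset_leq_card/subsetP => x.
  by rewrite !inE => /and3P[-> -> ->].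
exists (S1 :|: S2); split.
- by rewrite subUset S1Z.
- have S1h' : #|S1| * h <= 2 * #|Z|.
    rewrite -(leq_pmul2r t_gt0) mulnAC.
    apply: leq_trans (_ : #|X| * h <= _); first by rewrite leq_mul2r S1h orbT.
    by apply: leq_trans hXZ _; rewrite expnS; nia.
  by have := cardsUI S1 S2; nia.
- move=> s /setUP[/S1ne//|/S2ne /set0Pn[x]].
  by rewrite !inE => /and3P[xs _ xX]; apply/set0Pn; exists x; rewrite !inE xs.
- apply/subsetP => x xX; rewrite bigcup_setU !inE.
  have [//|xN] := boolP (x \in \bigcup_(s in S1) cov s).
  by apply: (subsetP S2cov); rewrite inE xN.
Qed.

(** A new vertex [x] next to a visited [c] is inserted as a detour from [c] to [x] and back, at two
    steps per vertex. *)
Lemma spanning_walk (T : finType) (r : rel T) (X : {set T}) (u : T) :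
    symmetric r -> u \in X ->
    (forall C : {set T}, C \proper X -> u \in C ->
       exists c x, [/\ c \in C, x \in X :\: C & r c x]) ->
  exists p : seq T, [/\ path r u p, size p = (#|X|.-1).*2 & u :: p =i X].
Proof.
move=> rs uX conn.
have step k : k < #|X| -> exists p : seq T,
    [/\ path r u p, size p = k.*2, {subset u :: p <= X} &
        #|[set x in u :: p]| = k.+1].
  elim: k => [_|k IH ltk].
    exists [::]; split=> //; first by move=> x; rewrite inE => /eqP->.
    by rewrite -(cards1 u); apply: eq_card => x; rewrite !inE.
  have [p [pp sp subp cp]] := IH (ltnW ltk).
  have subC : [set x in u :: p] \subset X.
    by apply/subsetP => x; rewrite inE => /subp.
  have [||c [x [cC xX rcx]]] := conn [set x in u :: p].
  - by rewrite properEcard subC cp.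
  - by rewrite !inE eqxx.
  have {cC} cp' : c \in u :: p by rewrite inE in cC.
  have {xX} [xX xN] : x \in X /\ x \notin u :: p.
    by move: xX; rewrite !inE => /andP[-> ->].
  have [p1 [p2 [Ep Ec]]] : exists p1 p2, p = p1 ++ p2 /\ c = last u p1.
    by case/splitPl: cp' => p1 p2 <-; exists p1, p2.
  have memE : (u :: p1 ++ x :: c :: p2) =i x :: u :: p.
    move=> y; rewrite Ep !(inE, mem_cat).
    have [->|] := eqVneq y x; first by rewrite !orbT.
    have [->|] := eqVneq y c; last by rewrite !orFb.
    move=> _; rewrite !orbT; symmetry.
    by move: cp'; rewrite Ep !(inE, mem_cat).
  exists (p1 ++ x :: c :: p2); split.
  - move: pp; rewrite Ep !cat_path /= -Ec => /andP[-> ->].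
    by rewrite rcx rs rcx.
  - by move: sp; rewrite Ep !size_cat /= doubleS; lia.
  - move=> y; rewrite memE inE => /orP[/eqP->//|]; exact: subp.
  - have -> : #|[set y in u :: p1 ++ x :: c :: p2]| = #|x |: [set y in u :: p]|.
      by apply: eq_card => y; rewrite in_set memE !inE.
    by rewrite cardsU1 inE xN cp.
have X_gt0 : 0 < #|X| by apply/card_gt0P; exists u.
have [|p [pp sp subp cp]] := step #|X|.-1; first by rewrite prednK.
exists p; split=> // x.
have -> : X = [set x in u :: p].
  apply/esym/eqP; rewrite eqEcard cp prednK // leqnn andbT.
  by apply/subsetP => y; rewrite inE => /subp.
by rewrite !inE.
Qed.

(** * Derandomised sampling *)

Section Sampling.
Local Open Scope ring_scope.

(* The right-hand side is the expectation of the left-hand side when [S] is a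
   random subset of [X] of density [p]; conditioning on one point at a time
   replaces the probability space. *)
Lemma sampling (R : realDomainType) (T I : finType) (p : R) (D : I -> {set T})
    (a : I -> R) (X : {set T}) (w : I -> R) :
  0 <= p <= 1 ->
  exists S : {set T}, S \subset X /\
    #|S|%:R + \sum_i w i * a i ^+ #|S :&: D i| <=
    p * #|X|%:R + \sum_i w i * (1 + p * (a i - 1)) ^+ #|X :&: D i|.
Proof.
move=> /andP[p0 p1]; move: {2}#|X| (erefl #|X|) => m.
elim: m X w => [|m IH] X w.
  move/eqP; rewrite cards_eq0 => /eqP->; exists set0; split=> //.
  by rewrite cards0 mulr0 lerD2l; apply: ler_sum => i _; rewrite set0I cards0.
move=> cX; have [x xX] : exists x, x \in X by apply/card_gt0P; rewrite cX.
have cX' : #|X :\ x| = m by move: cX; rewrite (cardsD1 x) xX add1n => -[].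
pose b i := 1 + p * (a i - 1).
have step i : b i ^+ #|X :&: D i| =
    b i ^+ #|(X :\ x) :&: D i| * (if x \in D i then b i else 1).
  rewrite (cardsD1 x) !inE xX /=; have -> : (X :&: D i) :\ x = (X :\ x) :&: D i.
    by apply/setP => y; rewrite !inE andbA.
  by case: ifP => _; rewrite ?mulr1 // exprS mulrC.
have [S0 [S0X S0le]] := IH _ w cX'.
have [S1 [S1X S1le]] := IH _ (fun i => w i * (if x \in D i then a i else 1)) cX'.
have xS (S : {set T}) : S \subset X :\ x -> x \notin S.
  by move=> /subsetP sub; apply/negP => /sub; rewrite !inE eqxx.
set avg := (X in exists S, _ /\ _ <= X).
set G0 := (X in _ <= _ + X) in S0le; set G1 := (X in _ <= _ + X) in S1le.
(* The bound is the average, with weights p and 1 - p, of those for taking and for skipping [x];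
   hence one of the two choices achieves it. *)
have Eavg : avg = p * (1 + (p * #|X :\ x|%:R + G1))
    + (1 - p) * (p * #|X :\ x|%:R + G0).
  have Esum : \sum_i w i * b i ^+ #|X :&: D i| = p * G1 + (1 - p) * G0.
    rewrite /G0 /G1 !mulr_sumr -big_split /=; apply: eq_bigr => i _.
    by rewrite step -/(b i) /b; case: ifP => _; ring.
  by rewrite /avg Esum cX cX' -natr1; ring.
have S1le' : #|x |: S1|%:R + \sum_i w i * a i ^+ #|(x |: S1) :&: D i| <=
    1 + (p * #|X :\ x|%:R + G1).
  rewrite cardsU1 (xS _ S1X) natrD -addrA lerD2l; apply: le_trans S1le.
  rewrite lerD2l; apply: ler_sum => i _; rewrite (cardsD1 x) !inE eqxx /=.
  have -> : ((x |: S1) :&: D i) :\ x = S1 :&: D i.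
    apply/setP => y; rewrite !inE; have [->|//] := eqVneq y x.
    by rewrite (negPf (xS _ S1X)).
  by rewrite exprD mulrA; case: (x \in D i); rewrite ?expr1 ?expr0.
have S0X' := subset_trans S0X (subsetDl _ _).
have S1X' : x |: S1 \subset X.
  by rewrite subUset sub1set xX (subset_trans S1X (subsetDl _ _)).
set F0 := (X in X <= _) in S0le; set F1 := (X in X <= _) in S1le'.
have [le10|lt01] := lerP F1 F0; [exists (x |: S1)|exists S0]; split=> //;
  rewrite -/F1 -/F0 Eavg; nra.
Qed.

Lemma natr_sum_indicator (R : realDomainType) (T : finType) (A : {pred T})
    (f : T -> R) :
  (forall x, 0 <= f x) -> (forall x, x \in A -> 1 <= f x) ->
  #|A|%:R <= \sum_x f x.
Proof.
move=> f0 f1; rewrite -sum1_card natr_sum big_mkcond /=.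
by apply: ler_sum => x _; case: ifP => [/f1|].
Qed.

Section ThresholdSample.
Variables (R : realType) (T : finType) (N : T -> {set T}).

Definition majority (k : nat) (S0 S1 S2 : {set T}) : {set T} :=
  ([set z | (k <= #|S0 :&: N z|)%N] :|: S1) :\: S2.

(** Exponential Markov bounds. At density 32 c ln d / d^2 a big [z] expects at least 32 ln d sample
    points and a small one at most ln d, while the threshold 5t lies between 5 log2 d and 10 log2 d.
    [S1] and [S2] repair the wrong decisions; vertices neither big nor small may be decided either
    way. *)
Lemma threshold_sample (X Y : {set T}) (c d t : nat) :
    (0 < t)%N -> (2 <= d)%N -> (d <= 2 ^ t)%N -> (2 ^ t <= d ^ 2)%N ->
    32 * c%:R * ln d%:R <= d%:R ^+ 2 :> R ->
    (forall z, X :&: N z != set0 -> z \in Y) ->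
  exists S0 S1 S2 : {set T},
    [/\ S0 \subset X, S1 \subset Y & S2 \subset Y] /\
    [/\ (forall z, (d ^ 2 <= c * #|X :&: N z|)%N ->
          z \in majority (5 * t) S0 S1 S2),
        (forall z, z \in majority (5 * t) S0 S1 S2 ->
          (d ^ 2 <= 32 * (c * #|X :&: N z|))%N) &
        #|S0|%:R + #|S1|%:R + #|S2|%:R <=
          32 * c%:R * ln d%:R / d%:R ^+ 2 * #|X|%:R + 2 * #|Y|%:R / d%:R ^+ 4 :> R].
Proof.
move=> t0 d2 dt td dbig XY; set l : R := ln d%:R; set k := (5 * t)%N.
have d0 : (0 < d%:R :> R) by rewrite ltr0n; lia.
have l0 : 0 <= l by rewrite ln_ge0 // ler1n; lia.
have El : expR l = d%:R by rewrite lnK // posrE.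
have d20 : 0 < d%:R ^+ 2 :> R by rewrite exprn_gt0.
pose p := 32 * c%:R * l / d%:R ^+ 2.
have p01 : 0 <= p <= 1.
  rewrite /p ler_pdivrMr // mul1r dbig andbT.
  by rewrite divr_ge0 ?mulr_ge0 ?ler0n // ltW.
pose big z := (d ^ 2 <= c * #|X :&: N z|)%N.
pose small z := (32 * (c * #|X :&: N z|) < d ^ 2)%N.
(* The factor 1/2 penalises too few sample points at a big [z], the factor 2 too many at a small
   one; [w] is scaled so that each wrong decision contributes at least 1. *)
pose a (z : T) : R := if big z then 2^-1 else 2.
pose w (z : T) : R := if z \in Y then
  if big z then 2 ^+ k else if small z then 2 ^- k else 0 else 0.
have big_small z : big z -> small z = false.
  rewrite /small ltnNge => bz; apply/negbTE; rewrite negbK.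
  exact: leq_trans bz (leq_pmull _ _).
have w0 z : 0 <= w z.
  rewrite /w; case: ifP => // _; case: ifP => _; first by rewrite exprn_ge0.
  by case: ifP => _ //; rewrite invr_ge0 exprn_ge0.
have a0 z : 0 <= a z by rewrite /a; case: ifP; rewrite ?invr_ge0.
have [S0 [S0X S0le]] := sampling N a X w p01.
pose S1 := [set z in Y | big z && (#|S0 :&: N z| < k)%N].
pose S2 := [set z in Y | small z && (k <= #|S0 :&: N z|)%N].
have k0 : (0 < k)%N by rewrite /k; lia.
have Epow : (d%:R ^+ 5 <= 2 ^+ k :> R) /\ (2 ^+ k <= d%:R ^+ 10 :> R).
  rewrite /k mulnC exprM -!natrX !ler_nat; split.
    by rewrite leq_exp2r.
  by rewrite (_ : 10 = 2 * 5)%N // expnM leq_exp2r.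
(* The exponents of d: 10 - 16 for a big vertex, -5 + 1 for a small one; both are at most -4. *)
have terms z : w z * (1 + p * (a z - 1)) ^+ #|X :&: N z| <=
    if z \in Y then d%:R ^- 4 else 0.
  rewrite /w; case: ifP => _; last by rewrite mul0r.
  have [bz|nbz] := boolP (big z).
    rewrite /a bz; set n := #|_|.
    have nb : d%:R ^+ 2 <= c%:R * n%:R :> R by rewrite -natrX -natrM ler_nat.
    have pn : 32 * l <= p * n%:R.
      by rewrite /p mulrAC ler_pdivlMr //; nra.
    have -> : 1 + p * (2^-1 - 1) = 1 + - (p / 2) by lra.
    have le1 : (1 + - (p / 2)) ^+ n <= d%:R ^- 16.
      apply: le_trans (_ : expR (- (p / 2)) ^+ n <= _).
        rewrite lerXn2r ?nnegrE ?expR_ge0 //; last exact: expR_ge1Dx.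
        by case/andP: p01 => _ p1; lra.
      rewrite -expRM_natl -El -expRM_natl -expRN ler_expR; lra.
    apply: le_trans (ler_pM _ _ (proj2 Epow) le1) _.
    - by rewrite exprn_ge0.
    - by rewrite exprn_ge0 //; case/andP: p01 => _ p1; lra.
    rewrite (_ : 16 = 10 + 6)%N // exprD invfM mulrA mulfV ?expf_neq0 ?gt_eqF //.
    rewrite mul1r lef_pV2 ?posrE ?exprn_gt0 //.
    by apply: ler_weXn2l => //; rewrite ler1n; apply: ltnW.
  case: ifP => [sz|_]; last by rewrite mul0r invr_ge0 exprn_ge0 // ltW.
  rewrite /a (negPf nbz); set n := #|_|.
  have nb : 32 * c%:R * n%:R <= d%:R ^+ 2 :> R.
    by rewrite -natrX -!natrM ler_nat -mulnA ltnW.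
  have pn : p * n%:R <= l.
    by rewrite /p mulrAC ler_pdivrMr //; nra.
  have -> : 1 + p * (2 - 1) = 1 + p by lra.
  have le1 : (1 + p) ^+ n <= d%:R.
    apply: le_trans (_ : expR p ^+ n <= _).
      rewrite lerXn2r ?nnegrE ?expR_ge0 ?expR_ge1Dx //.
      by case/andP: p01 => p00 _; lra.
    by rewrite -expRM_natl -El ler_expR; lra.
  have k5 : 2 ^- k <= d%:R ^- 5 :> R.
    by rewrite lef_pV2 ?posrE ?exprn_gt0 //; case: Epow.
  apply: le_trans (ler_pM _ _ k5 le1) _.
  - by rewrite invr_ge0 exprn_ge0.
  - by rewrite exprn_ge0 //; case/andP: p01 => p00 _; lra.
  by rewrite exprS invfM mulrAC mulVf ?gt_eqF // mul1r.
have S12 : #|S1|%:R + #|S2|%:R <= \sum_z w z * a z ^+ #|S0 :&: N z|.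
  have dis : [disjoint S1 & S2].
    rewrite -setI_eq0 -subset0; apply/subsetP => z.
    rewrite !inE => /andP[/and3P[_ _ lt] /and3P[_ _ ge]].
    by move: lt; rewrite ltnNge ge.
  rewrite -natrD -(eqP (_ : #|S1 :|: S2| == #|S1| + #|S2|)%N); last first.
    by rewrite (leq_card_setU S1 S2).
  apply: natr_sum_indicator => z; first by rewrite mulr_ge0 ?exprn_ge0.
  rewrite !inE => /orP[/and3P[zY bz lt]|/and3P[zY sz ge]].
    rewrite /w zY bz /a bz exprVn -expfB // -?(ltnW lt) ?exprn_ege1 ?ler1n //.
  have nbz : big z = false.
    by apply: contraTF sz => /big_small ->.
  rewrite /w zY nbz sz /a nbz mulrC ler_pdivlMr ?exprn_gt0 // mul1r.
  by apply: ler_weXn2l => //; rewrite ler1n.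
exists S0, S1, S2; split.
  split=> //.
    by apply/subsetP => z; rewrite inE; case/andP.
  by apply/subsetP => z; rewrite inE; case/andP.
split.
- move=> z bz; rewrite !inE.
  have zY : z \in Y.
    apply: XY; rewrite -card_gt0 lt0n; apply: contraTneq bz => ->.
    by rewrite muln0 leqn0 expn_eq0; case: (d) d2.
  by rewrite (big_small _ bz) zY (bz : big z) /=; case: leqP.
- move=> z; rewrite !inE => /andP[nS2 /orP[ge|/andP[_ /andP[bz _]]]]; last first.
    exact: leq_trans bz (leq_pmull _ _).
  rewrite leqNgt; apply/negP => sz; move: nS2; rewrite /small sz ge /= andbT.
  rewrite XY // -card_gt0; apply: leq_trans (_ : #|S0 :&: N z| <= _)%N.
    exact: leq_trans k0 ge.
  by apply/subset_leq_card/setSI.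
- rewrite -addrA; apply: le_trans (lerD (lexx _) S12) _.
  apply: le_trans S0le _; rewrite -/p lerD2l.
  apply: le_trans (ler_sum _ (fun z _ => terms z)) _.
  rewrite -big_mkcond sumr_const -[X in X <= _]mulr_natl -mulrA.
  by rewrite ler_peMl ?ler1n // mulr_ge0 ?ler0n // invr_ge0 exprn_ge0 // ltW.
Qed.
End ThresholdSample.

End Sampling.

(** * Local structure at a cutset *)

Section Lattice.
Variables (V D : finType) (act : V -> D -> V) (opp : D -> D) (ev : pred V).
Variable (d : nat).
Implicit Types (x y z e o u v w : V) (a b : D) (S T X Y : {set V}).

Definition deg (x : V) (S : {set V}) : nat := #|[set a | act x a \in S]|.

Definition Nb (S : {set V}) : {set V} := [set x | 0 < deg x S].

Definition N2 (z : V) : {set V} :=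
  [set e | (e != z) && [exists a, exists b, act (act z a) b == e]].

(** [SY] stands for the greedy odd vertices outside A, [Kpp] for the set decided by majority.
    Neither A nor the cutset occurs in these definitions, because decoding has only the recorded
    sets. *)
Definition K0 (SY Kpp : {set V}) : {set V} :=
  [set x | ev x && ((x \in Nb SY) || (x \in Kpp))].

Definition K1 (SY Kpp : {set V}) : {set V} :=
  [set x | ~~ ev x && (3 * d <= 2 * deg x (K0 SY Kpp))].

Definition alive (SY Kpp : {set V}) : {set V} :=
  ~: (K0 SY Kpp :|: K1 SY Kpp).

Definition arel (SY Kpp : {set V}) : rel V :=
  [rel x y | [&& [exists a, act x a == y], x \in alive SY Kpp &
               y \in alive SY Kpp]].

Definition reach (SY Kpp Z : {set V}) : {set V} :=
  [set y | [exists z in Z, connect (arel SY Kpp) z y]].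

Definition approx (h : nat) (SY Kpp SW Z : {set V}) : {set V} :=
  [set o | ~~ ev o && ((o \in Nb SW) ||
     (h <= deg o [set y in reach SY Kpp Z | ev y]))].

Hypothesis cardD : #|D| = 2 * d.
Hypothesis actC : forall x a b, act (act x a) b = act (act x b) a.
Hypothesis actK : forall x a, act (act x a) (opp a) = x.
Hypothesis oppK : involutive opp.
Hypothesis act_inj : forall x, injective (act x).
Hypothesis ev_act : forall x a, ev (act x a) = ~~ ev x.
Hypothesis common : forall x z, z != x ->
  #|[set a | [exists b, act (act x a) b == z]]| <= 4.

Lemma actKV x a : act (act x (opp a)) a = x.
Proof. by rewrite -{2}[a]oppK actK. Qed.

Lemma deg_le x S : deg x S <= 2 * d.
Proof. by rewrite -cardD max_card. Qed.

Lemma degS x S T : S \subset T -> deg x S <= deg x T.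
Proof.
by move=> /subsetP ST; apply/subset_leq_card/subsetP => a; rewrite !inE => /ST.
Qed.

Lemma degC x S : deg x S + deg x (~: S) = 2 * d.
Proof.
rewrite -cardD -(cardsC [set a | act x a \in S]); congr (_ + _).
by apply: eq_card => a; rewrite !inE.
Qed.

Lemma degU x S T : deg x (S :|: T) <= deg x S + deg x T.
Proof.
apply: leq_trans (leq_card_setU _ _); apply/subset_leq_card/subsetP => a.
by rewrite !inE.
Qed.

Lemma deg_gt0P x S : reflect (exists a, act x a \in S) (0 < deg x S).
Proof.
apply: (iffP card_gt0P) => -[a]; rewrite ?inE => aS; exists a => //.
by rewrite inE.
Qed.

(** Double counting of the edges between [X] and [Y], weighted by the endpoint in [Y]. *)
Lemma deg_exchange (X Y : {set V}) (f : V -> nat) :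
  \sum_(x in X) \sum_(a | act x a \in Y) f (act x a) =
  \sum_(y in Y) f y * deg y X.
Proof.
under eq_bigr => x _ do rewrite big_mkcond.
rewrite exchange_big /=.
have E a : \sum_(x in X) (if act x a \in Y then f (act x a) else 0) =
    \sum_(y in Y) (if act y (opp a) \in X then f y else 0).
  rewrite big_mkcond (reindex (fun y => act y (opp a))) /=; last first.
    by exists (act^~ a) => y _; rewrite ?actKV ?actK.
  rewrite [RHS]big_mkcond; apply: eq_bigr => y _; rewrite actKV.
  by case: ifP; case: ifP.
rewrite (eq_bigr _ (fun a _ => E a)) exchange_big /=.
apply: eq_bigr => y _; rewrite (reindex_inj (inv_inj oppK)) /=.
under eq_bigr do rewrite oppK.
by rewrite -big_mkcond sum_nat_cond_const mulnC /deg cardsE.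
Qed.

Lemma sum_deg (X Y : {set V}) :
  \sum_(x in X) deg x Y = \sum_(y in Y) deg y X.
Proof.
transitivity (\sum_(y in Y) 1 * deg y X).
  rewrite -(deg_exchange X Y (fun=> 1)); apply: eq_bigr => x _.
  by rewrite /deg -sum1_card; apply: eq_bigl => a; rewrite inE.
by apply: eq_bigr => y _; rewrite mul1n.
Qed.

(** The number of two-step walks from [z] into [S]. Up to the 2d returns to [z] it is comparable
    with the number of points of [S] at distance 2, and it is easier to sum over edges. *)
Definition omega (S : {set V}) (z : V) : nat := \sum_a deg (act z a) S.

Lemma omegaE S z : omega S z =
  \sum_(e in S) #|[set a | [exists b, act (act z a) b == e]]|.
Proof.
transitivity (\sum_a \sum_(e in S) [exists b, act (act z a) b == e] : nat).
  apply: eq_bigr => a _; rewrite /deg.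
  rewrite -(card_imset _ (@act_inj (act z a))) -sum1_card big_mkcond.
  rewrite [RHS]big_mkcond; apply: eq_bigr => e _.
  have -> : (e \in [set act (act z a) b | b in [set b | act (act z a) b \in S]])
    = (e \in S) && [exists b, act (act z a) b == e].
    apply/imsetP/andP => [[b]|[eS /existsP[b /eqP E]]].
      by rewrite inE => bS ->; split=> //; apply/existsP; exists b.
    by exists b; rewrite ?inE ?E.
  by case: (e \in S) => //=; case: ifP.
rewrite exchange_big /=; apply: eq_bigr => e _.
by rewrite -sum1_card [RHS]big_mkcond; apply: eq_bigr => a _; rewrite inE.
Qed.

Lemma omega_le S z : omega S z <= 4 * #|S :&: N2 z| + 2 * d.
Proof.
rewrite omegaE -sum1_card big_distrr /=.
apply: leq_trans (_ : \sum_(e in S :&: N2 z) 4 +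
   \sum_(e in S) (if e == z then 2 * d else 0) <= _); last first.
  rewrite leq_add //; case: (boolP (z \in S)) => zS.
    rewrite (bigD1 z) //= eqxx big1 ?addn0 // => e /andP[_ /negPf->] //.
  by rewrite big1 // => e eS; case: eqP eS zS => // -> ->.
have -> : \sum_(e in S :&: N2 z) 4 = \sum_(e in S) (if e \in N2 z then 4 else 0).
  by rewrite -big_mkcondr; apply: eq_bigl => e; rewrite !inE.
rewrite -big_split /=; apply: leq_sum => e _.
have [->|nez] := eqVneq e z.
  by apply: leq_trans (max_card _) _; rewrite cardD leq_addl.
rewrite addn0; case: ifP => [_|]; first exact: common.
rewrite inE nez /= => /negbT; rewrite negb_exists => /forallP nE.
rewrite leqn0 cards_eq0 -subset0; apply/subsetP => a; rewrite inE => aE.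
by have := nE a; rewrite aE.
Qed.

Lemma le_omega S z : #|S :&: N2 z| <= omega S z.
Proof.
rewrite omegaE -sum1_card.
have -> : \sum_(e in S :&: N2 z) 1 = \sum_(e in S) (if e \in N2 z then 1 else 0).
  by rewrite -big_mkcondr; apply: eq_bigl => e; rewrite !inE.
apply: leq_sum => e _; case: ifP => //; rewrite inE => /andP[_ /existsP[a aE]].
by apply/card_gt0P; exists a; rewrite inE.
Qed.

(** * Degrees across an odd cut and the vertices almost surrounded by A *)

Section Cut.
(** In the application [A] is A_1(Gamma), [k0] the integer part of sqrt d, [h] half of [k0] rounded
    down, and [M] = |Gamma_r|. *)
Variables (A : {set V}) (k0 h M : nat).
Hypothesis evA : forall x a, x \in A -> ev x -> act x a \in A.
Hypothesis d_big : 600 <= d.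
Hypothesis k0_d : k0 ^ 2 <= d.
Hypothesis h_k0 : 2 * h <= k0.+1.

Definition odds : {set V} := [set v in A | ~~ ev v].
Definition outs : {set V} := [set u in ~: A | ev u && (0 < deg u A)].
Definition rough : {set V} :=
  [set v in odds | (0 < deg v (~: A)) && (k0 < deg v A)].

Hypothesis rough_M : \sum_(v in rough) deg v (~: A) <= M.

Lemma k0_small : 8 * k0 <= d.
Proof. nia. Qed.

Lemma oddA y a : ~~ ev y -> y \notin A -> act y a \notin A.
Proof.
move=> oy; apply: contra => aA; rewrite -(actK y a).
by apply: evA => //; rewrite ev_act.
Qed.

Lemma in_odds x a : x \in A -> ev x -> act x a \in odds.
Proof. by move=> xA ex; rewrite inE evA // ev_act ex. Qed.

Lemma out_outs v a : v \in odds -> act v a \notin A -> act v a \in outs.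
Proof.
rewrite !inE => /andP[vA ov] ->; rewrite ev_act ov /=.
by apply/deg_gt0P; exists (opp a); rewrite actK.
Qed.

Lemma deg_outs v : v \in odds -> deg v outs = deg v (~: A).
Proof.
move=> vO; apply: eq_card => a; rewrite !inE; apply/idP/idP => [/andP[]//|aN].
by have := out_outs vO aN; rewrite !inE.
Qed.

(** If [act v b] is in A, then, being even, it has all its neighbours in A, among them
    [act (act v b) a], which is the neighbour of [act v a] in direction [b]. So each of the 2d
    directions is counted on at least one side. *)
Lemma opposite_degrees v a : v \in odds -> act v a \notin A ->
  2 * d <= deg v (~: A) + deg (act v a) A.
Proof.
rewrite inE => /andP[vA ov] aN; rewrite -cardD -cardsT.
apply: leq_trans (leq_card_setU _ _); apply/subset_leq_card/subsetP => b _.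
rewrite !inE -implybE; apply/implyP => bA; rewrite actC evA //.
by rewrite ev_act ov.
Qed.

Definition steep (u : V) : {set D} :=
  [set a | (act u a \in A) && (d <= 8 * deg (act u a) (~: A))].

(** The bound on steep directions, those to vertices of A with many exits, is what lets
    near-surroundedness pass to parallel vertices in [pure_exit]. *)
Definition pure : {set V} :=
  [set u in outs | (15 * d <= 8 * deg u A) && (16 * #|steep u| <= d)].

Definition gentle (u : V) : {set D} := [set a | act u a \in A] :\: steep u.

Lemma gentleP u a : a \in gentle u ->
  act u a \in A /\ 8 * deg (act u a) (~: A) < d.
Proof.
rewrite !inE => /andP[nS aA]; split=> //.
by move: nS; rewrite aA /= -ltnNge.
Qed.

Lemma gentle_card u : u \in pure -> 29 * d <= 16 * #|gentle u|.
Proof.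
rewrite inE => /and3P[_ ud us].
have : deg u A <= #|gentle u| + #|steep u|.
  apply: leq_trans (leq_card_setU _ _); apply/subset_leq_card/subsetP => a.
  by rewrite !inE => ->; rewrite andbT; case: (d <= _).
lia.
Qed.

(** A small [omega] allows few steep directions, so a vertex with more than d/16 neighbours in A has
    a gentle one. Its end has fewer than d/8 exits, and [opposite_degrees] then gives [u] at least
    15d/8 neighbours in A. *)
Lemma outs_pure u : u \in outs -> 128 * omega outs u <= d ^ 2 ->
  16 * deg u A <= d \/ u \in pure.
Proof.
move=> uO om; have [|ubig] := leqP (16 * deg u A) d; [by left|right].
have uE : ev u /\ u \notin A by move: uO; rewrite !inE => /and3P[-> ->].
have stO a : act u a \in A -> act u a \in odds.
  by move=> aA; rewrite inE aA ev_act uE.1.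
have st : 16 * #|steep u| <= d.
  have : #|steep u| * d <= 8 * omega outs u.
    rewrite -sum_nat_const /omega big_distrr /= big_mkcond.
    apply: leq_sum => a _; case: ifP => //; rewrite inE => /andP[aA].
    by rewrite deg_outs // stO.
  nia.
have [a aG] : exists a, a \in gentle u.
  apply/card_gt0P.
  have : deg u A <= #|gentle u| + #|steep u|.
    apply: leq_trans (leq_card_setU _ _); apply/subset_leq_card/subsetP => a.
    by rewrite !inE => ->; rewrite andbT; case: (d <= _).
  lia.
have [aA ad] := gentleP aG.
have := @opposite_degrees (act u a) (opp a) (stO _ aA).
rewrite actK => /(_ uE.2) le2; rewrite inE uO st andbT; lia.
Qed.

Lemma gentle_rough u a : u \in outs -> a \in gentle u -> act u a \in rough.
Proof.
rewrite !inE => /and3P[uN eu _] /andP[aS aA]; have k0s := k0_small.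
rewrite aA ev_act eu /= in aS *; move: aS; rewrite -ltnNge => aS.
apply/andP; split; first by apply/deg_gt0P; exists (opp a); rewrite actK inE.
by have := degC (act u a) A; lia.
Qed.

(** Gentle neighbours are rough and number at least [d]; the edges to them are cut edges counted in
    [M]. *)
Lemma pure_card : #|pure| * d <= M.
Proof.
apply: leq_trans (_ : \sum_(u in pure) deg u rough <= _).
  rewrite -sum_nat_const; apply: leq_sum => u uP.
  apply: leq_trans (_ : #|gentle u| <= _).
    by have := gentle_card uP; lia.
  have uO : u \in outs by move: uP; rewrite inE => /andP[].
  apply/subset_leq_card/subsetP => a aG; rewrite inE; exact: gentle_rough.
rewrite sum_deg; apply: leq_trans rough_M; apply: leq_sum => v _.
apply: degS; apply/subsetP => u; rewrite [u \in pure]inE => /andP[].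
by rewrite inE => /andP[].
Qed.

Variable L : nat.
Hypothesis sum_L : \sum_(v in odds) deg v (~: A) = L.
(** This is how eps >= d^(-1/2) enters, combined with eps L < M. It absorbs the vertices that have
    at most [k0] neighbours in A. *)
Hypothesis k0_L : k0 * L <= d * M.
Hypothesis odds_in : forall v, v \in odds -> 0 < deg v A.
Hypothesis outs_out : forall u, u \in outs -> 0 < deg u (~: A).
Hypothesis boundary_lb : forall S, S \subset A :|: outs -> d < #|S| ->
  d.-1 * k0 <= \sum_(x in S) deg x (~: S).

(** * Deletion of marked vertices confines the surviving components *)

Section Blocking.
Variables (SY Kpp SW Z : {set V}).
Hypothesis SY_out : forall y, y \in SY -> (y \notin A) && ~~ ev y.
Hypothesis SY_sat : forall y, y \notin A -> ~~ ev y ->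
  deg y (pure :\: Nb SY) < h.
Hypothesis Kpp_omega : forall z, ev z -> z \notin Kpp ->
  128 * omega outs z <= d ^ 2.

Notation K0' := (K0 SY Kpp).
Notation K1' := (K1 SY Kpp).

Lemma K0A x : x \in A -> x \in K0' -> x \in Kpp.
Proof.
move=> xA; rewrite inE => /andP[ex /orP[|//]].
rewrite inE => /deg_gt0P[a /SY_out /andP[/negP[]]]; exact: evA.
Qed.

Lemma outsK0 u : u \in outs -> u \notin K0' ->
  16 * deg u A <= d \/ u \in pure.
Proof.
move=> uO; have eu : ev u by move: uO; rewrite !inE => /and3P[].
rewrite inE eu /= negb_or => /andP[_ uK]; apply: outs_pure => //.
exact: Kpp_omega.
Qed.

(** Shift the star of [u] to [y]: a gentle direction of [u] leads from [y] to an outer vertex with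
    more than 15d/8 neighbours in A, hence marked or pure. Saturation leaves fewer than [h] unmarked
    pure ones, so at least 29d/16 - h >= 3d/2 neighbours of [y] are marked. *)
Lemma pure_exit y a : y \notin A -> ~~ ev y -> act y a \in pure ->
  y \in K1'.
Proof.
move=> yA oy uP; rewrite inE oy /=; set u := act y a in uP *.
have uO : u \in outs by move: uP; rewrite inE => /andP[].
have Ey : y = act u (opp a) by rewrite actK.
have sub : gentle u \subset
    [set b | act y b \in K0'] :|: [set b | act y b \in pure :\: Nb SY].
  apply/subsetP => b bG; have [bA bd] := gentleP bG.
  have Ez : act (act u b) (opp a) = act y b by rewrite actC -Ey.
  have zA : act y b \notin A by apply: oddA.
  have bO : act u b \in odds.
    by rewrite inE bA ev_act ev_act oy.
  have := opposite_degrees (a := opp a) bO; rewrite Ez => /(_ zA) le2.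
  have zO : act y b \in outs by rewrite -Ez; apply: out_outs; rewrite ?Ez.
  apply/setUP; have [zK|zK] := boolP (act y b \in K0').
    by left; rewrite in_set.
  right; rewrite in_set; have [|zP] := outsK0 zO zK.
    by move=> le3; clear -le2 bd le3 d_big; lia.
  by apply/setDP; split=> //; apply: contra zK => zN; rewrite inE zN ev_act oy.
have := gentle_card uP; have := SY_sat yA oy.
have : #|gentle u| <= deg y K0' + deg y (pure :\: Nb SY).
  by apply: leq_trans (subset_leq_card sub) (leq_card_setU _ _).
have := k0_small; lia.
Qed.

(** Otherwise [u] has at most d/16 neighbours in A. Then [v] has at most d/16 neighbours in A and
    fewer than d/8 pure ones (more would make [omega outs u] large), so at least 5d/16 unmarked
    neighbours of [v] are outer vertices with few neighbours in A. Shifted to [z], they make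
    [omega outs z] too large if [z] is in A, and leave no room for the gentle directions if [z] is
    pure. *)
Lemma good_step v b a : v \in odds -> v \notin K1' ->
    act v b \notin K0' -> act v b \in A :|: pure ->
  act v a \notin K0' -> act v a \in A :|: pure.
Proof.
move=> vO vK1 zK0 zG uK0.
have [vA ov] : v \in A /\ ~~ ev v by move: vO; rewrite inE => /andP[].
set z := act v b in zK0 zG *; set u := act v a in uK0 *.
have ez : ev z by rewrite /z ev_act.
have eu : ev u by rewrite /u ev_act.
apply: contraT; rewrite in_setU negb_or => /andP[uA uP].
have uO : u \in outs by apply: out_outs.
have ubad : 16 * deg u A <= d.
  by case: (outsK0 uO uK0) => // uP'; rewrite uP' in uP.
have vout : 31 * d <= 16 * deg v (~: A).
  by have := opposite_degrees vO uA; rewrite -/u; clear -ubad; lia.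
have vin : 16 * deg v A <= d by have := degC v A; clear -vout; lia.
have om x : ev x -> x \notin K0' -> 128 * omega outs x <= d ^ 2.
  by move=> ex; rewrite inE ex /= negb_or => /andP[_]; apply: Kpp_omega.
have steps x (X : {set D}) (k : nat) : (forall c, c \in X -> 15 * d <= 8 * deg (act x c) outs) ->
    5 * d <= 16 * #|X| + k * d -> k <= 4 -> d ^ 2 < 128 * omega outs x.
  move=> hX cX k4; have : #|X| * (15 * d) <= 8 * omega outs x.
    rewrite -sum_nat_const /omega big_distrr /= big_mkcond.
    by apply: leq_sum => c _; case: ifP => // /hX.
  have := d_big; clear -cX k4; nia.
pose AL := [set c | act v c \notin K0'].
have cAL : d < 2 * #|AL|.
  have -> : #|AL| = deg v (~: K0') by apply: eq_card => c; rewrite !inE.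
  by move: vK1; rewrite inE ov /= -ltnNge; have := degC v K0'; clear; lia.
pose PU := [set c | act v c \in pure].
have cPU : 8 * #|PU| < d.
  rewrite ltnNge; apply/negP => PUbig.
  have := om u eu uK0; rewrite leqNgt => /negP[].
  apply: (steps u (PU :\: [set c | act u c \in A]) 4) => // [c|]; last first.
    have := subset_leq_card (subsetIr PU [set c | act u c \in A]).
    have := cardsID [set c | act u c \in A] PU.
    by move: ubad PUbig; rewrite /deg; clear; lia.
  rewrite !inE -/(act u c) => /andP[yA /and3P[uO' ud _]].
  apply: leq_trans ud _; rewrite leq_mul2l /=.
  apply/subset_leq_card/subsetP => e; rewrite in_set in_set => eA.
  have Ey : act u c = act (act v c) a by rewrite /u actC.
  rewrite Ey actC.
  have vcO : act (act v c) e \in odds by rewrite inE eA !ev_act ov.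
  have /(out_outs vcO) : act (act (act v c) e) a \notin A.
    rewrite actC -Ey; apply: oddA => //.
    by rewrite ev_act eu.
  by [].
pose BD := AL :\: ([set c | act v c \in A] :|: PU).
have cBD : 5 * d <= 16 * #|BD|.
  have : #|AL| <= #|BD| + (deg v A + #|PU|).
    rewrite -(cardsID ([set c | act v c \in A] :|: PU) AL) addnC leq_add2l.
    apply: leq_trans (leq_card_setU _ _).
    exact/subset_leq_card/subsetIr.
  by move: cAL vin cPU; clear; lia.
have BDP c : c \in BD -> act v c \notin A /\ 16 * deg (act v c) A <= d.
  move=> /setDP[]; rewrite in_set => cK; rewrite in_setU negb_or.
  rewrite in_set in_set => /andP[cA cP]; split=> //.
  by case: (outsK0 (out_outs vO cA) cK) => // cP'; rewrite cP' in cP.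
have [zA|zP] : z \in A \/ z \in pure by apply/setUP.
  have := om z ez zK0; rewrite leqNgt => /negP[].
  apply: (steps z BD 0) => // [c /BDP[cA cd]|]; last by rewrite mul0n addn0.
  have wO : act z c \in odds by apply: in_odds.
  have Ew : act (act z c) (opp b) = act v c by rewrite /z actC actK.
  have := opposite_degrees (a := opp b) wO; rewrite Ew => /(_ cA).
  by rewrite deg_outs //; clear -cd; lia.
(* From [z], a direction of [BD] into A leads to at least 31d/16 exits, a gentle one to fewer than
   d/8. The conflict is 29d/16 + 5d/16 > 2d. *)
have dis : [disjoint gentle z & BD].
  rewrite -setI_eq0 -subset0; apply/subsetP => c /setIP[/gentleP[wA wd]].
  move=> /BDP[cA cd].
  have Ew : act (act z c) (opp b) = act v c by rewrite /z actC actK.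
  have wO : act z c \in odds by rewrite inE wA ev_act ez.
  have := opposite_degrees (a := opp b) wO; rewrite Ew => /(_ cA).
  by move: cd wd d_big; clear; lia.
have := gentle_card zP.
have : #|gentle z| + #|BD| <= 2 * d.
  rewrite -cardD; apply: leq_trans (max_card (mem (gentle z :|: BD))).
  by have := (leq_card_setU (gentle z) BD).2; rewrite dis => /eqP->.
by have := d_big; move: cBD; clear; lia.
Qed.

Notation arel' := (arel SY Kpp).
Notation alive' := (alive SY Kpp).

(* Preserved along surviving edges, so it confines the component of any seed. *)
Definition good x : bool :=
  (x \in alive') && (if ev x then x \in A :|: pure else (x \in odds) &&
     [exists b, (act x b \notin K0') && (act x b \in A :|: pure)]).

Lemma aliveE x : (x \in alive') = (x \notin K0') && (x \notin K1').
Proof. by rewrite !inE negb_or. Qed.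

Lemma good_arel x y : good x -> arel' x y -> good y.
Proof.
rewrite /good => /andP[xL gx] /and3P[/existsP[a /eqP Ey] _ yL]; rewrite yL /=.
move: gx; rewrite -{y}Ey in yL *; rewrite ev_act.
move: xL yL; rewrite !aliveE => /andP[xK0 xK1] /andP[yK0 yK1].
have [ex xG|ex] := boolP (ev x); last first.
  move=> /andP[xO /existsP[b /andP[bK0 bG]]] /=.
  exact: good_step xO xK1 bK0 bG yK0.
have yO : act x a \in odds.
  have [xA|xP] := setUP xG; first exact: in_odds.
  rewrite inE ev_act ex andbT; apply: contraT => yA.
  have := @pure_exit (act x a) (opp a) yA; rewrite ev_act ex actK.
  by move=> /(_ isT xP); rewrite (negPf yK1).
by rewrite yO; apply/existsP; exists (opp a); rewrite actK xK0.
Qed.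

Lemma good_connect x y : good x -> connect arel' x y -> good y.
Proof.
move=> gx /connectP[p]; elim: p x gx => [|z p IH] x gx /=; first by move=> _ ->.
by move=> /andP[/(good_arel gx) gz]; apply: IH.
Qed.

Definition flat : {set V} := [set v in odds | deg v A <= k0].

Lemma flat_card : #|flat| * d <= L.
Proof.
rewrite -sum_L -sum_nat_const; apply: leq_trans (_ : \sum_(v in flat) deg v (~: A) <= _).
  apply: leq_sum => v; rewrite inE => /andP[_ vk].
  by have := degC v A; have := k0_small; move: vk d_big; clear; lia.
rewrite [X in _ <= X]big_mkcond [X in X <= _]big_mkcond; apply: leq_sum => v _.
by rewrite inE; case: (v \in odds) => //=; case: ifP.
Qed.

(** The walks with middle vertex [v] number at most exits(v) times deg(v, A). Rough vertices give at
    most 2dM in total, the others at most k0 L <= dM. *)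
Lemma sum_omega_A : \sum_(w in A | ev w) omega outs w <= 3 * d * M.
Proof.
have E : \sum_(w in A | ev w) omega outs w <=
    \sum_(v in odds) deg v (~: A) * deg v A.
  rewrite (eq_bigl (fun w => w \in [set w in A | ev w])); last by move=> w; rewrite !inE.
  apply: leq_trans (_ : \sum_(v in odds) deg v (~: A) * deg v [set w in A | ev w]
    <= _); last by apply: leq_sum => v _; rewrite leq_mul2l degS ?orbT //;
    apply/subsetP => w; rewrite inE => /andP[].
  rewrite -(deg_exchange _ _ (fun v => deg v (~: A))); apply: leq_sum => w.
  rewrite in_set => /andP[wA ew]; rewrite /omega [X in _ <= X]big_mkcond.
  by apply: leq_sum => a _; rewrite in_odds // deg_outs ?in_odds.
apply: leq_trans E _.
apply: leq_trans (_ : \sum_(v in odds) ((if v \in rough then deg v (~: A) else 0)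
   * (2 * d) + deg v (~: A) * k0) <= _).
  apply: leq_sum => v vO; have [//|vk] := leqP (deg v A) k0.
    by move=> vk; rewrite -[X in X <= _]add0n leq_add // leq_mul2l vk orbT.
  rewrite [v \in rough]inE vO vk andbT; have [v0|] := posnP (deg v (~: A)).
    by rewrite v0.
  move=> v0 /=; apply: leq_trans (leq_addr _ _).
  by rewrite leq_mul2l deg_le orbT.
rewrite big_split -!big_distrl sum_L /=.
rewrite -big_mkcondr (eq_bigl (fun v => v \in rough)) => [|v]; last first.
  by rewrite inE andb_idl // !inE => /andP[].
by move: rough_M k0_L; set s := \sum_(_ in _) _; nia.
Qed.

Definition core : {set V} := [set w in A | ev w && (w \in Kpp)].

Lemma core_card (c : nat) :
  (forall z, z \in Kpp -> d ^ 2 <= 32 * (c * #|outs :&: N2 z|)) ->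
  #|core| * d <= 96 * (c * M).
Proof.
move=> hK; have d0 : 0 < d by move: d_big; clear; lia.
rewrite -(leq_pmul2r d0) -mulnA mulnn -sum_nat_const.
apply: leq_trans (_ : \sum_(w in core) 32 * (c * omega outs w) <= _).
  apply: leq_sum => w; rewrite inE => /and3P[_ _ /hK].
  by move=> /leq_trans->//; rewrite !leq_mul2l le_omega !orbT.
rewrite -!big_distrr /= (_ : _ * _ * _ = 32 * (c * (3 * d * M))); last first.
  by clear; lia.
rewrite !leq_mul2l; apply/orP; right; apply/orP; right.
apply: leq_trans sum_omega_A.
rewrite [X in _ <= X]big_mkcond [X in X <= _]big_mkcond; apply: leq_sum => w _.
by rewrite inE; case: (w \in A) => //=; case: (ev w) => //=; case: ifP.
Qed.

Definition bad_evens : {set V} :=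
  [set w in A | ev w && ((w \in Kpp) || (d <= deg w K1'))].

(** Excluding [bad_evens] leaves a seed more than [d] surviving neighbours, so its component is
    large enough for [boundary_lb]. *)
Definition seeds : {set V} :=
  [set w in A | [&& ev w, w \notin bad_evens & 0 < deg w rough]].

Hypothesis SW_A : forall w, w \in SW -> (w \in A) && ev w.
Hypothesis SW_cover : forall v, v \in rough -> h <= deg v bad_evens ->
  v \in Nb SW.
Hypothesis Z_seeds : Z \subset seeds.
Hypothesis Z_cover : forall w, w \in seeds ->
  exists2 z, z \in Z & connect arel' z w.

Lemma seed_alive w : w \in seeds -> w \in alive'.
Proof.
rewrite inE => /and4P[wA ew]; rewrite inE wA ew /= negb_or => /andP[wK _] _.
rewrite aliveE [w \in K1']inE ew andbT; apply: contra wK; exact: K0A.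
Qed.

Lemma seed_good w : w \in seeds -> good w.
Proof.
move=> ws; rewrite /good seed_alive //; move: ws.
by rewrite !inE => /and4P[-> ->].
Qed.

(** An odd vertex outside A has no neighbour in A, so its neighbours in good components are pure and
    not in [Nb SY]; saturation allows fewer than [h] of them. *)
Lemma approx_sub : approx h SY Kpp SW Z \subset A.
Proof.
apply/subsetP => o; rewrite inE => /andP[oo /orP[|]].
  rewrite inE => /deg_gt0P[a /SW_A /andP[aA ea]]; rewrite -(actK o a).
  exact: evA.
apply: contraLR => oA; rewrite -ltnNge; apply: leq_ltn_trans (SY_sat oA oo).
apply/subset_leq_card/subsetP => a; rewrite in_set => aR.
rewrite in_set; apply/setDP.
move: aR; rewrite in_set => /andP[]; rewrite in_set => /existsP[z /andP[zZ zy]] ey.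
have gz := seed_good (subsetP Z_seeds z zZ).
have := good_connect gz zy; rewrite /good ey aliveE => /andP[/andP[aK0 _]].
rewrite in_setU (negPf (oddA a oo oA)) /= => ->; split=> //.
by move: aK0; rewrite inE ey /= negb_or => /andP[].
Qed.

(** A rough vertex has at least k0 + 1 >= 2h neighbours in A. Either [h] of them are bad and [SW]
    covers it, or more than [h] are seeds, all of which are reached from [Z]. *)
Lemma rough_approx : rough \subset approx h SY Kpp SW Z.
Proof.
apply/subsetP => v vR.
have [vA ov vk] : [/\ v \in A, ~~ ev v & k0 < deg v A].
  by move: vR; rewrite !inE => /andP[/andP[-> ->] /andP[_ ->]].
rewrite inE ov /=; have [hb|hb] := leqP h (deg v bad_evens).
  by rewrite SW_cover.
apply/orP; right.
have : deg v A <= deg v bad_evens +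
    deg v [set y in reach SY Kpp Z | ev y].
  apply: leq_trans (leq_card_setU _ _); apply/subset_leq_card/subsetP => a.
  rewrite [in X in X -> _]inE => aA; apply/setUP.
  have [aB|aB] := boolP (act v a \in bad_evens); [left|right].
    by rewrite in_set.
  have /Z_cover[z zZ cz] : act v a \in seeds.
    rewrite inE aA aB ev_act ov /=; apply/deg_gt0P; exists (opp a).
    by rewrite actK.
  by rewrite in_set in_set ev_act ov andbT inE; apply/existsP; exists z;
    rewrite zZ.
by move: hb vk h_k0; clear; lia.
Qed.

(** * Counting edges from good vertices to deleted ones *)

Definition hub : {set V} := [set o in odds | 3 * d <= 4 * deg o core].

Lemma hub_card : 3 * #|hub| <= 8 * #|core|.
Proof.
have d0 : 0 < d by move: d_big; clear; lia.
rewrite -(leq_pmul2r d0).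
have : #|hub| * (3 * d) <= 4 * (#|core| * (2 * d)).
  rewrite -!sum_nat_const.
  apply: leq_trans (_ : \sum_(o in hub) 4 * deg o core <= _).
    by apply: leq_sum => o; rewrite inE => /andP[].
  rewrite -big_distrr leq_mul2l /= sum_deg; apply: leq_sum => w _.
  exact: deg_le.
by clear; lia.
Qed.

Lemma K0_core x : ~~ ev x -> deg x K0' <= deg x core + deg x (~: A).
Proof.
move=> ox; apply: leq_trans (leq_card_setU _ _); apply/subset_leq_card/subsetP.
move=> a; rewrite in_set => aK; apply/setUP; have [aA|aA] := boolP (act x a \in A).
  by left; rewrite !inE aA ev_act ox /=; apply: K0A.
by right; rewrite !inE.
Qed.

(** Of the 3d/2 marked neighbours, half lie in [core] or half lie outside A. *)
Lemma K1_hub o : o \in odds -> o \in K1' ->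
  o \in hub \/ 3 * d <= 4 * deg o (~: A).
Proof.
move=> oO oK; have [|nh] := boolP (o \in hub); [by left|right].
have oo : ~~ ev o by move: oO; rewrite inE => /andP[].
move: nh; rewrite inE oO /= -ltnNge; have := K0_core oo.
by move: oK; rewrite inE oo /=; clear; lia.
Qed.

(** A bad vertex outside [Kpp] has at least [d] deleted neighbours. Its small [omega] lets at most
    d/96 of them have 3d/4 exits, so at least d/2 are hubs. *)
Lemma bad_evens_card : #|bad_evens| <= 12 * #|core|.
Proof.
pose X := [set w in bad_evens | w \notin Kpp].
have cX : #|bad_evens| <= #|core| + #|X|.
  apply: leq_trans (leq_card_setU _ _); apply/subset_leq_card/subsetP => w.
  by rewrite !inE => /and3P[-> -> ->]; case: (w \in Kpp).
have XP w : w \in X -> d <= 2 * deg w hub.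
  rewrite !inE => /andP[/and3P[wA ew] /[swap] wK]; rewrite (negPf wK) /= => wd.
  have om := Kpp_omega ew wK.
  pose Y := [set a | (act w a \in odds) && (3 * d <= 4 * deg (act w a) (~: A))].
  have : deg w K1' <= deg w hub + #|Y|.
    apply: leq_trans (leq_card_setU _ _); apply/subset_leq_card/subsetP => a.
    rewrite in_set => aK; apply/setUP; have aO := in_odds a wA ew.
    by case: (K1_hub aO aK) => aP; [left|right]; rewrite in_set ?aO.
  have : #|Y| * (3 * d) <= 4 * omega outs w.
    rewrite -sum_nat_const /omega big_distrr /= big_mkcond; apply: leq_sum => a _.
    by rewrite in_set; case: ifP => // /andP[aO]; rewrite deg_outs.
  by move: om wd d_big; clear; nia.
have : #|X| * d <= 4 * (#|hub| * d).
  have -> : 4 * (#|hub| * d) = 2 * (#|hub| * (2 * d)) by clear; lia.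
  rewrite -!sum_nat_const; apply: leq_trans (_ : \sum_(w in X) 2 * deg w hub <= _).
    exact: leq_sum.
  rewrite -big_distrr leq_mul2l /= sum_deg; apply: leq_sum => w _.
  exact: deg_le.
rewrite mulnA leq_mul2r; have := hub_card; move: d_big cX; clear; lia.
Qed.

Definition sharp : {set V} := [set v in flat | good v].

(** A sharp vertex has more than d/2 unmarked neighbours, all in A or pure by [good_step], and at
    most k0 <= d/8 of them in A; so at least d/4 are pure. From a pure vertex such an edge is steep,
    and it has at most d/16 steep directions. *)
Lemma sharp_card : 4 * #|sharp| <= #|pure|.
Proof.
have d0 : 0 < d by move: d_big; clear; lia.
have sh v : v \in sharp -> d <= 4 * deg v pure.
  rewrite !inE => /andP[/andP[/andP[vA ov] vk]].
  rewrite /good aliveE (negPf ov) => /andP[/andP[_ vK1] /andP[vO /existsP[b]]].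
  move=> /andP[bK0 bG].
  have : deg v (~: K0') <= deg v A + deg v pure.
    apply: leq_trans (degU _ _ _); apply/subset_leq_card/subsetP => a.
    rewrite in_set inE in_set => aK0; exact: good_step bG aK0.
  move: vK1; rewrite inE ov /= -ltnNge; have := degC v K0'; have := k0_small.
  by move: vk d_big; clear; lia.
rewrite -(leq_pmul2r d0).
have : #|sharp| * d <= 4 * \sum_(u in pure) #|steep u|.
  rewrite -sum_nat_const; apply: leq_trans (_ : \sum_(v in sharp) 4 * deg v pure <= _).
    exact: leq_sum.
  rewrite -big_distrr leq_mul2l /= sum_deg; apply: leq_sum => u _.
  apply/subset_leq_card/subsetP => a; rewrite in_set in_set.
  rewrite in_set => /andP[]; rewrite in_set => /andP[]; rewrite in_set.
  move=> /andP[-> _] vk _ /=; have := degC (act u a) A; have := k0_small.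
  by move: vk d_big; clear; lia.
have : 16 * \sum_(u in pure) #|steep u| <= #|pure| * d.
  rewrite -sum_nat_const big_distrr /=; apply: leq_sum => u.
  by rewrite inE => /and3P[].
by clear; lia.
Qed.

Lemma sum_odd_exits :
  \sum_(x | good x && ~~ ev x) deg x K0' <= 2 * M + #|core| * (2 * d).
Proof.
have godd x : good x && ~~ ev x -> x \in odds.
  by move=> /andP[/andP[_]] /[swap] /negPf-> /andP[].
apply: leq_trans (_ : \sum_(x | good x && ~~ ev x)
    ((deg x core + (if x \in rough then deg x (~: A) else 0)) +
     (if x \in sharp then 2 * d else 0)) <= _).
  apply: leq_sum => x gx; have xO := godd x gx; case/andP: gx => gx ox.
  apply: leq_trans (K0_core ox) _; rewrite -addnA leq_add2l.
  have [xs|xs] := boolP (x \in sharp).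
    by apply: leq_trans (leq_addl _ _); apply: deg_le.
  rewrite addn0; case: ifP => // /negbT xr.
  move: xr xs; rewrite inE xO [x \in sharp]inE gx andbT inE xO /=.
  by rewrite -ltnNge lt0n => xr xs; move: xr; rewrite xs andbT negbK => /eqP->.
rewrite !big_split /=.
have h1 : \sum_(x | good x && ~~ ev x) deg x core <= #|core| * (2 * d).
  rewrite -sum_nat_const; apply: leq_trans (_ : \sum_(x in odds) deg x core <= _).
    rewrite big_mkcond [X in _ <= X]big_mkcond; apply: leq_sum => x _.
    by case: ifP => // /godd->.
  by rewrite sum_deg; apply: leq_sum => w _; apply: deg_le.
have h2 : \sum_(x | good x && ~~ ev x)
    (if x \in rough then deg x (~: A) else 0) <= M.
  apply: leq_trans rough_M; rewrite -big_mkcondr big_mkcond.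
  rewrite [X in _ <= X]big_mkcond; apply: leq_sum => x _.
  by case: ifP => // /andP[_ ->].
have h3 : \sum_(x | good x && ~~ ev x) (if x \in sharp then 2 * d else 0) <= M.
  apply: leq_trans (_ : #|sharp| * (2 * d) <= _).
    rewrite -sum_nat_const -big_mkcondr big_mkcond [X in _ <= X]big_mkcond.
    by apply: leq_sum => x _; case: ifP => // /andP[_ ->].
  by have := sharp_card; have := pure_card; clear; nia.
by move: h1 h2 h3; clear; lia.
Qed.

Lemma sum_even_exits :
  \sum_(x | good x && ev x) deg x K1' <= 6 * M + #|hub| * (2 * d).
Proof.
apply: leq_trans (_ : \sum_(x | good x && ev x)
    ((if x \in A then deg x (odds :&: K1') else 0) +
     (if x \in pure then 2 * d else 0)) <= _).
  apply: leq_sum => x /andP[]; rewrite /good => /andP[_] /[swap] ex.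
  rewrite ex => /setUP[xA|->]; last by apply: leq_trans (leq_addl _ _); apply: deg_le.
  rewrite xA; apply: leq_trans (leq_addr _ _).
  apply/subset_leq_card/subsetP => a; rewrite in_set => aK.
  by rewrite in_set; apply/setIP; split=> //; apply: in_odds.
rewrite big_split /=.
have h1 : \sum_(x | good x && ev x) (if x \in pure then 2 * d else 0) <= 2 * M.
  apply: leq_trans (_ : #|pure| * (2 * d) <= _).
    rewrite -sum_nat_const -big_mkcondr big_mkcond [X in _ <= X]big_mkcond.
    by apply: leq_sum => x _; case: ifP => // /andP[_ ->].
  by have := pure_card; clear; nia.
have h2 : \sum_(x | good x && ev x) (if x \in A then deg x (odds :&: K1') else 0)
    <= 4 * M + #|hub| * (2 * d).
  apply: leq_trans (_ : \sum_(o in odds :&: K1') deg o A <= _).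
    rewrite -sum_deg -big_mkcondr big_mkcond [X in _ <= X]big_mkcond.
    by apply: leq_sum => x _; case: ifP => // /andP[_ ->].
  apply: leq_trans (_ : \sum_(o in odds) ((if o \in hub then 2 * d else 0) +
     ((if o \in flat then k0 else 0) +
      (if o \in rough then 3 * deg o (~: A) else 0))) <= _).
    rewrite big_mkcond [X in _ <= X]big_mkcond; apply: leq_sum => o _.
    rewrite in_setI; have [oO|//] := boolP (o \in odds); case: ifP => // oK.
    have [->|od] := K1_hub oO oK.
      by apply: leq_trans (leq_addr _ _); apply: deg_le.
    apply: leq_trans (leq_addl _ _); have [ok|ok] := leqP (deg o A) k0.
      by rewrite [o \in flat]inE oO ok; apply: leq_trans (leq_addr _ _).
    apply: leq_trans (leq_addl _ _); rewrite [o \in rough]inE oO ok andbT.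
    have := deg_le o A; case: posnP => [|_]; first by move: od d_big; clear; lia.
    by move: od; clear=> /=; lia.
  rewrite !big_split /=.
  have h3 : \sum_(o in odds) (if o \in hub then 2 * d else 0) <= #|hub| * (2 * d).
    rewrite -sum_nat_const -big_mkcondr big_mkcond [X in _ <= X]big_mkcond.
    by apply: leq_sum => x _; case: ifP => // /andP[_ ->].
  have h4 : \sum_(o in odds) (if o \in flat then k0 else 0) <= M.
    apply: leq_trans (_ : #|flat| * k0 <= _).
      rewrite -sum_nat_const -big_mkcondr big_mkcond [X in _ <= X]big_mkcond.
      by apply: leq_sum => x _; case: ifP => // /andP[_ ->].
    have d0 : 0 < d by move: d_big; clear; lia.
    rewrite -(leq_pmul2r d0); have := flat_card; move: k0_L; clear; nia.
  have h5 : \sum_(o in odds) (if o \in rough then 3 * deg o (~: A) else 0)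
      <= 3 * M.
    apply: leq_trans (_ : 3 * \sum_(o in rough) deg o (~: A) <= _); last first.
      by rewrite leq_mul2l rough_M.
    rewrite big_distrr /= -big_mkcondr big_mkcond [X in _ <= X]big_mkcond.
    by apply: leq_sum => x _; case: ifP => // /andP[_ ->].
  by move: h3 h4 h5; clear; lia.
by move: h1 h2; clear; lia.
Qed.

Lemma sum_exits : \sum_(x | good x) deg x (~: alive') <=
  8 * (M + #|core| * d).
Proof.
rewrite (bigID ev) /=.
have h1 : \sum_(x | good x && ev x) deg x (~: alive') <=
    \sum_(x | good x && ev x) deg x K1'.
  apply: leq_sum => x /andP[_ ex]; apply/subset_leq_card/subsetP => a.
  rewrite in_set in_setC aliveE negb_and !negbK in_set => /orP[|//].
  by rewrite inE ev_act ex.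
have h2 : \sum_(x | good x && ~~ ev x) deg x (~: alive') <=
    \sum_(x | good x && ~~ ev x) deg x K0'.
  apply: leq_sum => x /andP[_ ex]; apply/subset_leq_card/subsetP => a.
  rewrite in_set in_setC aliveE negb_and !negbK in_set => /orP[//|].
  by rewrite inE ev_act ex.
have := sum_odd_exits; have := sum_even_exits; have := hub_card.
by move: h1 h2; clear; nia.
Qed.

Lemma arel_sym : symmetric arel'.
Proof.
move=> x y; apply/and3P/and3P => -[/existsP[a /eqP <-]] -> ->; split=> //;
  by apply/existsP; exists (opp a); rewrite actK.
Qed.

Hypothesis Z_sep : {in Z &, forall z z', z != z' -> ~~ connect arel' z z'}.

Lemma seed_card w : w \in seeds -> d < #|[set x | connect arel' w x]|.
Proof.
move=> ws; have wL := seed_alive ws.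
have [wA ew] : w \in A /\ ev w by move: ws; rewrite inE => /and3P[].
have wd : deg w K1' < d.
  move: ws; rewrite inE => /and4P[_ _ + _].
  by rewrite inE wA ew /= negb_or -ltnNge => /andP[].
have : d < deg w (~: K1') by have := degC w K1'; move: wd; clear; lia.
move/leq_trans; apply.
rewrite /deg -(card_imset _ (@act_inj w)); apply/subset_leq_card/subsetP => x.
move=> /imsetP[a]; rewrite in_set in_setC => aK ->; rewrite in_set.
apply: connect1; apply/and3P; split=> //; first by apply/existsP; exists a.
by rewrite aliveE aK andbT inE ev_act ew.
Qed.

(** The components are disjoint and each has at least (d-1) k0 boundary edges. All these edges run
    from good to deleted vertices, so [sum_exits] bounds their total number. *)
Lemma Z_card : #|Z| * (d.-1 * k0) <= 8 * (M + #|core| * d).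
Proof.
pose C z := [set x | connect arel' z x].
have gC z x : z \in Z -> x \in C z -> good x.
  by move=> /(subsetP Z_seeds)/seed_good gz; rewrite in_set; apply: good_connect.
apply: leq_trans sum_exits; rewrite -sum_nat_const.
apply: leq_trans (_ : \sum_(z in Z) \sum_(x in C z) deg x (~: alive') <= _).
  apply: leq_sum => z zZ; apply: leq_trans (boundary_lb _ _) _.
  - apply/subsetP => x xC; have := gC z x zZ xC; rewrite /good => /andP[_].
    case: ifP => _; last by move=> /andP[]; rewrite !inE => /andP[->].
    move=> /setUP[xA|]; rewrite in_setU ?xA //.
    by rewrite [x \in pure]inE => /andP[-> _]; rewrite orbT.
  - exact: seed_card (subsetP Z_seeds z zZ).
  apply: leq_sum => x xC; apply/subset_leq_card/subsetP => a.
  rewrite in_set in_setC => aC; rewrite in_set in_setC; apply: contra aC => aL.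
  rewrite in_set.
  move: (xC); rewrite in_set => /connect_trans; apply; apply: connect1.
  apply/and3P; split=> //; first by apply/existsP; exists a.
  by case/andP: (gC z x zZ xC).
rewrite (exchange_big_dep good) /=; last by move=> z x zZ; apply: gC.
apply: leq_sum => x _; rewrite -[X in _ <= X]mul1n.
apply: leq_trans (_ : #|[set z in Z | x \in C z]| * deg x (~: alive') <= _).
  rewrite -sum_nat_const; apply: eq_leq; apply: eq_bigl => z; rewrite in_set //.
rewrite leq_mul2r; apply/orP; right; apply/card_le1_eqP => z z'.
rewrite in_set => /andP[zZ zC]; rewrite in_set => /andP[z'Z z'C].
have zx : connect arel' z x by rewrite in_set in zC.
have z'x : connect arel' z' x by rewrite in_set in z'C.
apply/eqP; rewrite eq_sym; apply: contraT => zz; have := Z_sep zZ z'Z zz.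
by rewrite (connect_trans zx) // (sym_connect_sym arel_sym).
Qed.

End Blocking.

(** * Lazy walks, density of the cut around an outer vertex, and the net *)

Definition step x (o : option D) : V := if o is Some a then act x a else x.

Definition walk x (s : seq (option D)) : V := foldl step x s.

(** Walks may pause ([None]), so this means distance at most [k]. *)
Definition near k : rel V :=
  [rel x y | [exists s : k.-tuple (option D), walk x s == y]].

Lemma nearP k x y :
  reflect (exists2 s : seq (option D), size s = k & walk x s = y) (near k x y).
Proof.
apply: (iffP existsP) => [[s /eqP <-]|[s sk <-]].
  by exists s; rewrite ?size_tuple.
by move/eqP in sk; exists (Tuple sk).
Qed.

Lemma near_refl k : reflexive (near k).
Proof.
move=> x; apply/nearP; exists (nseq k None); first exact: size_nseq.
by elim: k => //= k IH.
Qed.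

Lemma near_trans j k x y z : near j x y -> near k y z -> near (j + k) x z.
Proof.
move=> /nearP[s <- <-] /nearP[s' <- <-]; apply/nearP; exists (s ++ s').
  by rewrite size_cat.
by rewrite /walk foldl_cat.
Qed.

Lemma near_le j k x y : j <= k -> near j x y -> near k x y.
Proof. by move=> jk jxy; rewrite -(subnKC jk); apply: near_trans (near_refl _ _). Qed.

Lemma near_act x a : near 1 x (act x a).
Proof. by apply/nearP; exists [:: Some a]. Qed.

Lemma near_sym k : symmetric (near k).
Proof.
suff sub x y : near k x y -> near k y x by move=> x y; apply/idP/idP; apply: sub.
move=> /nearP[s <- <-] {k y}; elim: s x => [|o s IH] x /=.
  exact: near_refl.
have ox : near 1 (step x o) x.
  case: o => [a|]; last exact: near_refl.
  by rewrite /= -{2}(actK x a); apply: near_act.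
by rewrite -addn1; apply: near_trans ox; apply: IH.
Qed.

Lemma near2 x a b : near 2 x (act (act x a) b).
Proof. exact: near_trans (near_act _ _) (near_act _ _). Qed.

Lemma sum_act_le x (B : {set D}) (Y : {set V}) (f : V -> nat) :
  (forall a, a \in B -> act x a \in Y) ->
  \sum_(a in B) f (act x a) <= \sum_(y in Y) f y.
Proof.
move=> BY; rewrite -(big_imset f (h := act x)) /=; last by move=> a b _ _ /act_inj.
rewrite big_mkcond [X in _ <= X]big_mkcond; apply: leq_sum => y _.
by case: ifP => // /imsetP[a /BY aY ->]; rewrite aY.
Qed.

(** Let [v] in A be next to [e]. By [opposite_degrees], [v] has [d] exits or [e] has [d] neighbours
    in A. Each of these [d] directions gives a nearby vertex with at least d/2 cut edges: its far
    end or, failing that, by [opposite_degrees] again, the far end shifted by one step [b], into A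
    in the first case and out of A in the second. *)
Lemma edge_density e : e \in outs ->
  d ^ 2 <= 4 * \sum_(u in outs | near 4 e u) deg u A.
Proof.
move=> eO; pose N := [set u in outs | near 4 e u].
rewrite (eq_bigl (fun u => u \in N)); last by move=> u; rewrite [in RHS]in_set.
have [eA ee] : e \notin A /\ ev e by move: eO; rewrite !inE => /and3P[].
have degN v : v \in odds -> near 3 e v -> deg v N = deg v (~: A).
  move=> vO ev3; rewrite -deg_outs //; apply: eq_card => a; rewrite !in_set.
  rewrite andb_idr // => _.
  by apply: (@near_trans 3 1) ev3 _; apply: near_act.
have via (B : {set D}) (f : D -> V) (k : nat) : injective f ->
    (forall a, a \in B -> [/\ f a \in odds, near 3 e (f a) & k <= 2 * deg (f a) (~: A)]) ->
    #|B| * k <= 2 * \sum_(u in N) deg u A.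
  move=> f_inj fB; rewrite -(card_imset _ f_inj) -sum_nat_const.
  apply: leq_trans (_ : \sum_(v in f @: B) 2 * deg v N <= _).
    by apply: leq_sum => _ /imsetP[a /fB[aO a3 ak] ->]; rewrite degN.
  rewrite -big_distrr leq_mul2l /= sum_deg; apply: leq_sum => u _; apply: degS.
  apply/subsetP => _ /imsetP[a /fB[aO _ _] ->].
  by move: aO; rewrite inE => /andP[].
have viaN x (B : {set D}) (k : nat) :
    (forall a, a \in B -> [/\ act x a \in outs, near 4 e (act x a) &
       k <= 2 * deg (act x a) A]) -> #|B| * k <= 2 * \sum_(u in N) deg u A.
  move=> hB; apply: leq_trans (_ : \sum_(a in B) 2 * deg (act x a) A <= _).
    by rewrite -sum_nat_const; apply: leq_sum => a /hB[].
  rewrite -big_distrr leq_mul2l /=.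
  by apply: (@sum_act_le x B N (deg^~ A)) => a /hB[aO a4 _]; rewrite in_set aO.
have [a0 a0A] : exists a, act e a \in A.
  by apply/deg_gt0P; move: eO; rewrite inE => /and3P[].
set v := act e a0 in a0A.
have ov : ~~ ev v by rewrite /v ev_act ee.
have vO : v \in odds by rewrite inE a0A ov.
have Ee : act v (opp a0) = e by rewrite actK.
have [vd|vd] := leqP d (deg v (~: A)).
  pose B := [set a | act v a \in ~: A].
  pose B1 := [set a in B | d <= 2 * deg (act v a) A].
  have BO a : a \in B -> act v a \in outs.
    by rewrite in_set in_setC; apply: out_outs.
  have cB : #|B1| + #|B :\: B1| = deg v (~: A).
    rewrite /deg -/B -(cardsID B1 B); congr (#|pred_of_set _| + _).
    by apply/setP => a; rewrite in_setI andb_idl // in_set => /andP[].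
  have h1 : #|B1| * d <= 2 * \sum_(u in N) deg u A.
    apply: (viaN v) => a; rewrite in_set => /andP[aB aD]; split=> //.
      exact: BO.
    by apply: (@near_le 2) => //; apply: near2.
  have [b bA] := deg_gt0P _ _ (odds_in vO).
  have h2 : #|B :\: B1| * (3 * d) <= 2 * \sum_(u in N) deg u A.
    apply: (via _ (act (act v b))) => [|a /setDP[aB aB1]]; first exact: act_inj.
    have vaO : act (act v b) a \in odds by apply: in_odds; rewrite // ev_act ov.
    have E : act (act (act v b) a) (opp b) = act v a.
      by rewrite (actC v) actK.
    split=> //.
      by rewrite (actC v); apply: (@near_trans 2 1) (near2 _ _ _) (near_act _ _).
    have := opposite_degrees (a := opp b) vaO; rewrite E.
    move: (aB); rewrite in_set in_setC => aA /(_ aA).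
    by move: aB1; rewrite in_set aB /= -ltnNge; clear; lia.
  by move: h1 h2 cB vd; clear; nia.
pose B := [set a | act e a \in A].
pose B1 := [set a in B | d <= 2 * deg (act e a) (~: A)].
have BO a : a \in B -> act e a \in odds.
  by rewrite in_set inE ev_act ee => ->.
have cB : #|B1| + #|B :\: B1| = deg e A.
  rewrite /deg -/B -(cardsID B1 B); congr (#|pred_of_set _| + _).
  by apply/setP => a; rewrite in_setI andb_idl // in_set => /andP[].
have ed : d <= deg e A.
  by have := opposite_degrees (a := opp a0) vO; rewrite Ee => /(_ eA); lia.
have h1 : #|B1| * d <= 2 * \sum_(u in N) deg u A.
  apply: (via _ (act e)) => [|a]; first exact: act_inj.
  rewrite in_set => /andP[aB aD]; split=> //; first exact: BO.
  by apply: (@near_le 1) => //; apply: near_act.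
have [b] := deg_gt0P _ _ (outs_out eO); rewrite in_setC => bA.
have h2 : #|B :\: B1| * (3 * d) <= 2 * \sum_(u in N) deg u A.
  apply: (viaN (act e b)) => a /setDP[aB aB1].
  have zA : act (act e b) a \notin A by apply: oddA; rewrite // ev_act ee.
  have zE : act (act e a) b = act (act e b) a by rewrite actC.
  have aO := BO a aB.
  split; first by rewrite -zE; apply: out_outs; rewrite ?zE.
    by apply: (@near_le 2) => //; apply: near2.
  have := opposite_degrees (a := b) aO; rewrite zE => /(_ zA).
  by move: aB1; rewrite in_set aB /= -ltnNge; clear; lia.
by move: h1 h2 cB ed; clear; nia.
Qed.

Lemma sum_outs : \sum_(u in outs) deg u A = L.
Proof.
rewrite -sum_L (eq_bigr (deg^~ odds)) => [|u]; last first.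
  rewrite inE => /and3P[_ eu _]; apply: eq_card => a; rewrite !in_set.
  by rewrite andb_idr // ev_act eu.
by rewrite sum_deg; apply: eq_bigr => v vO; rewrite deg_outs.
Qed.

Lemma outs_card : #|outs| <= L.
Proof.
rewrite -sum_outs -sum1_card; apply: leq_sum => u.
by rewrite inE => /and3P[].
Qed.

Lemma L_lower : outs != set0 -> d ^ 2 <= 4 * L.
Proof.
move=> /set0Pn[e /edge_density] /leq_trans; apply; rewrite leq_mul2l /= -sum_outs.
by rewrite big_mkcondr; apply: leq_sum => u _; case: ifP.
Qed.

(** Balls of radius 4 around points at distance more than 8 are disjoint, and each carries at least
    d^2/4 of the [L] cut edges. *)
Lemma net_outs : exists S : {set V},
  [/\ S \subset outs, #|S| * d ^ 2 <= 4 * L &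
      forall e, e \in outs -> exists2 s, s \in S & near 8 s e].
Proof.
have [S [SO Scov Ssep]] := separated_net outs (near_refl 8) (near_sym 8).
exists S; split=> //; rewrite -sum_nat_const.
apply: leq_trans (_ : \sum_(s in S) 4 * \sum_(u in outs | near 4 s u) deg u A <= _).
  by apply: leq_sum => s /(subsetP SO)/edge_density.
rewrite -big_distrr leq_mul2l /= -sum_outs.
rewrite (exchange_big_dep (fun u => u \in outs)) /=; last by move=> ? ? _ /andP[].
apply: leq_sum => u uO; rewrite -[X in _ <= X]mul1n.
apply: leq_trans (_ : #|[set s in S | near 4 s u]| * deg u A <= _).
  by rewrite -sum_nat_const; apply: eq_leq; apply: eq_bigl => s; rewrite in_set uO.
rewrite leq_mul2r; apply/orP; right; apply/card_le1_eqP => s s'.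
rewrite in_set => /andP[sS su]; rewrite in_set => /andP[s'S s'u].
apply/eqP; apply: contraT => ss; have := Ssep _ _ s'S sS ss.
by rewrite (@near_trans 4 4 _ u) // near_sym.
Qed.

(** * Assembling the recorded sets near O *)

Definition collar : {set V} := [set x | [exists e in outs, near 2 e x]].

Lemma collarP e x : e \in outs -> near 2 e x -> x \in collar.
Proof. by move=> eO ex; rewrite in_set; apply/existsP; exists e; rewrite eO. Qed.

Lemma outs_collar : outs \subset collar.
Proof. by apply/subsetP => e eO; apply: collarP eO (near_refl _ _). Qed.

Lemma pure_outs : pure \subset outs.
Proof. by apply/subsetP => u; rewrite inE => /andP[]. Qed.

Lemma rough_nb_collar v w a : v \in rough -> act v a = w -> w \in collar.
Proof.
rewrite inE => /and3P[vO /deg_gt0P[b]]; rewrite in_setC => bA _ <-.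
apply: collarP (out_outs vO bA) _.
by rewrite -{2}(actK v b); apply: near2.
Qed.

Lemma covered_deg x (S : {set V}) :
  #|[set z in S | [exists a, act x a == z]]| = deg x S.
Proof.
rewrite /deg -(card_imset _ (@act_inj x)); apply: eq_card => z; rewrite in_set.
apply/andP/imsetP => [[zS /existsP[a /eqP E]]|[a]].
  by exists a; rewrite ?in_set ?E.
by rewrite in_set => aS ->; split=> //; apply/existsP; exists a.
Qed.

Definition star x : {set V} := [set z | [exists a, act x a == z]].

Lemma star_sym x y : (y \in star x) = (x \in star y).
Proof.
by rewrite !in_set; apply/existsP/existsP => -[a /eqP <-]; exists (opp a);
  rewrite actK.
Qed.

Lemma Nb_star (S : {set V}) : \bigcup_(s in S) star s = Nb S.
Proof.
apply/setP => x; rewrite in_set; apply/bigcupP/deg_gt0P => [[s sS]|[a aS]].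
  by rewrite star_sym in_set => /existsP[a /eqP E]; exists a; rewrite E.
by exists (act x a); rewrite // star_sym in_set; apply/existsP; exists a.
Qed.

Lemma pure_saturation : 0 < h -> exists SY : {set V},
  [/\ SY \subset collar, #|SY| * (h * d) <= M,
      (forall y, y \in SY -> (y \notin A) && ~~ ev y) &
      (forall y, y \notin A -> ~~ ev y -> deg y (pure :\: Nb SY) < h)].
Proof.
move=> h0.
have [S [SC Sh Sne Ssat]] :=
  greedy_saturation star [set y | (y \notin A) && ~~ ev y] pure h0.
exists S; split.
- apply/subsetP => s /Sne /set0Pn[u /setIP[su uP]].
  apply: (collarP (subsetP pure_outs u uP)).
  move: su; rewrite in_set => /existsP[a /eqP E].
  by rewrite -(actK s a) E; apply: (@near_le 1) => //; apply: near_act.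
- by rewrite mulnA; apply: leq_trans pure_card; rewrite leq_mul2r Sh orbT.
- by move=> y /(subsetP SC); rewrite in_set.
- move=> y yA oy; have := Ssat y; rewrite in_set yA oy => /(_ isT).
  rewrite Nb_star -covered_deg; apply: leq_ltn_trans.
  apply/subset_leq_card/subsetP => u; rewrite in_set => /andP[/setDP[uP uN] uy].
  by apply/setDP; split=> //; apply/setIP; split=> //; rewrite in_set.
Qed.

(** Applied to vertices missed by the majority set. The bounds on [c] and [d] enter as 512/1000 +
    256/600 < 1. *)
Lemma omega_small (c n z : nat) : 1000 <= c -> c * n < d ^ 2 ->
  z <= 4 * n + 2 * d -> 128 * z <= d ^ 2.
Proof. by move: d_big; clear; nia. Qed.

Lemma N2_card : #|[set z | outs :&: N2 z != set0]| <= 4 * d ^ 2 * L.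
Proof.
apply: leq_trans (_ : #|\bigcup_(e in outs)
    \bigcup_(a : D) [set act (act e a) b | b : D]| <= _).
  apply/subset_leq_card/subsetP => z; rewrite in_set => /set0Pn[e /setIP[eO]].
  rewrite in_set => /andP[_ /existsP[a /existsP[b /eqP E]]].
  apply/bigcupP; exists e => //; apply/bigcupP; exists (opp b) => //.
  by apply/imsetP; exists (opp a); rewrite // -E !actK.
have h1 (I : finType) (P : {pred I}) (F : I -> {set V}) (m : nat) :
    (forall i, #|F i| <= m) -> #|\bigcup_(i in P) F i| <= #|P| * m.
  move=> Fm; rewrite -sum_nat_const; elim/big_rec2: _ => [|i n X _ IH].
    by rewrite cards0.
  by apply: leq_trans (leq_card_setU _ _) _; apply: leq_add.
apply: leq_trans (h1 _ _ _ (4 * d ^ 2) _) _ => [e|].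
  apply: leq_trans (h1 _ _ _ (2 * d) _) _ => [a|].
    by apply: leq_trans (leq_imset_card _ _) _; rewrite cardD.
  by rewrite cardD; clear; lia.
by rewrite mulnC leq_mul2l outs_card orbT.
Qed.

Theorem local_data (R : realType) (c t : nat) :
    1000 <= c -> 0 < h -> 0 < t -> d <= 2 ^ t -> 2 ^ t <= d ^ 2 ->
    (32 * c%:R * ln d%:R <= d%:R ^+ 2 :> R)%R ->
  exists S0 S1 S2 SY SW Z S : {set V},
  let E := approx h SY (majority N2 (5 * t) S0 S1 S2) SW Z in
  [/\ rough \subset E, E \subset A,
      S0 :|: S1 :|: S2 :|: SY :|: SW :|: Z :|: S \subset collar &
      forall e, e \in outs -> exists2 s, s \in S & near 8 s e] /\
  [/\ (#|S0|%:R + #|S1|%:R + #|S2|%:R <=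
         32 * c%:R * ln d%:R / d%:R ^+ 2 * L%:R +
         2 * (4 * d%:R ^+ 2 * L%:R) / d%:R ^+ 4 :> R)%R,
      #|SY| * (h * d) <= M,
      #|SW| * (h * d) <= (t + 2) * (2304 * (c * M)),
      #|Z| * (d.-1 * k0) <= (8 + 768 * c) * M &
      #|S| * d ^ 2 <= 4 * L].
Proof.
move=> c_big h0 t0 dt td lnd.
have d0 : 0 < d by move: d_big; clear; lia.
pose Y := [set z | outs :&: N2 z != set0].
have [|z|S0 [S1 [S2 [[S0X S1Y S2Y] [K_in K_out Ksize]]]]] :=
    @threshold_sample R V N2 outs Y c d t t0 _ dt td lnd.
- by move: d_big; clear; lia.
- by rewrite in_set.
set Kpp := majority N2 (5 * t) S0 S1 S2 in K_in K_out.
have [SY [SYc SYh SYo SYs]] := pure_saturation h0.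
have Kom z : ev z -> z \notin Kpp -> 128 * omega outs z <= d ^ 2.
  move=> _ zK; apply: omega_small c_big _ (omega_le _ _).
  by rewrite ltnNge; apply: contra zK; apply: K_in.
pose Wb := bad_evens SY Kpp.
have cWb : #|Wb| * d <= 1152 * (c * M).
  have := bad_evens_card SYo Kom; have := core_card K_out.
  by rewrite -/Wb; clear; nia.
(* The exponent [t + 2] is there because a vertex covers at most 2d < 2^(t+2) rough ones. *)
have [v|w _|SW [SWb SWh SWne SWc]] := @logarithmic_cover V V star Wb h (t + 2)
    [set v in rough | h <= deg v Wb] h0.
- rewrite in_set => /andP[_ hv]; apply: leq_trans hv _; rewrite -covered_deg.
  apply/subset_leq_card/subsetP => z; rewrite in_set => /andP[zW zv].
  by rewrite in_set zW star_sym in_set.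
- apply: leq_ltn_trans (_ : 2 * d < _); last first.
    by rewrite expnD; move: dt d0; clear; lia.
  rewrite -cardD; apply: leq_trans (leq_imset_card (act w) D).
  apply/subset_leq_card/subsetP => z /setIP[zw _]; move: zw.
  by rewrite in_set; case/existsP=> a /eqP <-; apply/imsetP; exists a.
have [Z [Zs Zc Zsep]] := separated_net (seeds SY Kpp) (@connect0 _ (arel SY Kpp))
  (sym_connect_sym (arel_sym SY Kpp)).
have [S [SO Ssize Snear]] := net_outs.
have SWA w : w \in SW -> (w \in A) && ev w.
  by move=> /(subsetP SWb); rewrite in_set => /and3P[-> ->].
have SWcov v : v \in rough -> h <= deg v Wb -> v \in Nb SW.
  move=> vR hv; rewrite -Nb_star; apply: (subsetP SWc).
  by rewrite in_set vR hv.
exists S0, S1, S2, SY, SW, Z, S; split; split.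
- exact: rough_approx.
- exact: approx_sub.
- have Yc : Y \subset collar.
    apply/subsetP => z; rewrite in_set => /set0Pn[e /setIP[eO]].
    rewrite in_set => /andP[_ /existsP[a /existsP[b /eqP E]]].
    by apply: (collarP eO); rewrite near_sym -E; apply: near2.
  rewrite !subUset (subset_trans S0X outs_collar) (subset_trans S1Y Yc).
  rewrite (subset_trans S2Y Yc) SYc (subset_trans SO outs_collar) /= andbT.
  apply/andP; split; apply/subsetP => w.
    move=> /SWne/set0Pn[v /setIP[vw]]; rewrite [v \in _]in_set => /andP[vR _].
    move: vw; rewrite star_sym in_set => /existsP[a /eqP].
    exact: rough_nb_collar.
  move=> /(subsetP Zs); rewrite in_set => /and4P[_ _ _ /deg_gt0P[a aR]].
  by apply: (rough_nb_collar (a := opp a) aR); rewrite actK.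
- exact: Snear.
- apply: le_trans Ksize _; apply: lerD.
    rewrite ler_wpM2l ?ler_nat ?outs_card // divr_ge0 ?exprn_ge0 ?ler0n //.
    by rewrite mulr_ge0 ?mulr_ge0 ?ler0n // ln_ge0 // ler1n.
  rewrite ler_wpM2r ?invr_ge0 ?exprn_ge0 ?ler0n // ler_wpM2l ?ler0n //.
  by rewrite -natrX -!natrM ler_nat N2_card.
- exact: SYh.
- rewrite mulnA; apply: leq_trans (_ : 2 * (t + 2) * #|Wb| * d <= _).
    by rewrite leq_mul2r SWh orbT.
  by rewrite -mulnA; move: cWb; clear; nia.
- have := Z_card SYo SYs Kom Zs Zsep.
  by have := core_card K_out; clear; nia.
- exact: Ssize.
Qed.

End Cut.
End Lattice.

(** * The discrete torus and the box *)

Section Torus.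
Variables (d n : nat).

(* One residue more than the box has: a cycle of even length keeps the parity of
   vertices, and the extra residue [ord_max] leaves room outside the box. *)
Definition torus := {ffun 'I_d -> 'I_n.*2.+2}.
Definition dir := ('I_d * bool)%type.
Implicit Types (x y z : torus) (a b : dir).

Definition shift (s : bool) (c : 'I_n.*2.+2) := if s then ordS c else ord_pred c.

Definition tact x a : torus :=
  [ffun k => if k == a.1 then shift a.2 (x k) else x k].

Definition topp a : dir := (a.1, ~~ a.2).

(* [d * n] because the residue k stands for the coordinate k - n. *)
Definition tev x : bool := ~~ odd (\sum_k x k + d * n).

Lemma shiftK s : cancel (shift s) (shift (~~ s)).
Proof. by case: s => c; rewrite /shift ?ordSK ?ord_predK. Qed.

Lemma ordSE (c : 'I_n.*2.+2) : ordS c = (if c == ord_max then 0 else c.+1) :> nat.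
Proof.
rewrite /=; case: eqP => [->|/eqP]; first by rewrite modnn.
by rewrite -val_eqE /= => cm; rewrite modn_small // ltnS ltn_neqAle cm -ltnS ltn_ord.
Qed.

Lemma odd_shift s c : odd (shift s c) = ~~ odd c.
Proof.
have oddS (e : 'I_n.*2.+2) : odd (ordS e) = ~~ odd e.
  by rewrite ordSE; case: eqP => [->|//] /=; rewrite odd_double.
case: s; rewrite /shift; first exact: oddS.
by rewrite -{2}(ord_predK c) oddS negbK.
Qed.

Lemma card_dir : #|{: dir}| = 2 * d.
Proof. by rewrite card_prod card_ord card_bool mulnC. Qed.

Lemma tactC x a b : tact (tact x a) b = tact (tact x b) a.
Proof.
apply/ffunP => k; rewrite !ffunE; case: ifP => kb; case: ifP => ka //.
case: a b {ka kb} => [i s] [j t] /=.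
by case: s; case: t; rewrite /shift ?ordSK ?ord_predK.
Qed.

Lemma tactK x a : tact (tact x a) (topp a) = x.
Proof. by apply/ffunP => k; rewrite !ffunE /=; case: (k == a.1); rewrite ?shiftK. Qed.

Lemma toppK : involutive topp.
Proof. by case=> i s; rewrite /topp /= negbK. Qed.

Lemma tev_act x a : tev (tact x a) = ~~ tev x.
Proof.
rewrite /tev !oddD (bigD1 a.1) //= [in RHS](bigD1 a.1) //= !oddD.
rewrite ffunE eqxx odd_shift (eq_bigr (fun k => x k : nat)) => [|k /negPf nk].
  by rewrite !addNb !negbK.
by rewrite ffunE nk.
Qed.

Lemma shift_neq s c : shift s c != c.
Proof.
apply/eqP => /(congr1 (fun e : 'I_n.*2.+2 => odd e)).
by rewrite odd_shift; case: (odd c).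
Qed.

Hypothesis n_gt0 : 0 < n.

Lemma shift_inj c : injective (shift^~ c).
Proof.
have neq : ordS c != ord_pred c.
  apply/eqP => /(congr1 (@ordS _)); rewrite ord_predK => E.
  have := ordSE (ordS c); have := ordSE c; rewrite E; set e := ordS c.
  case: (c =P ord_max) => [->|_]; case: (e =P ord_max) => [->|_] /=; lia.
by move=> [] [] //= /eqP; rewrite ?(negPf neq) // eq_sym (negPf neq).
Qed.

Lemma tact_inj x : injective (tact x).
Proof.
move=> [i s] [j t] /ffunP E; have := E i; rewrite !ffunE eqxx /=.
case: (eqVneq i j) => [-> /shift_inj -> //|_ /eqP].
by rewrite (negPf (shift_neq _ _)).
Qed.

(** The first step of a two-step walk from [x] to [z] changes a coordinate in which they differ.
    There are at most two of these, each with two signs. *)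
Lemma card_common x z : z != x ->
  #|[set a | [exists b, tact (tact x a) b == z]]| <= 4.
Proof.
move=> zx; set X := [set a | _].
have [->|[a aX]] := set_0Vmem X; first by rewrite cards0.
move: aX; rewrite in_set => /existsP[b /eqP E].
apply: leq_trans (_ : #|setX [set a.1; b.1] [set: bool]| <= _); last first.
  rewrite cardsX cardsT card_bool.
  by have := leq_card_setU [set a.1] [set b.1]; case; rewrite !cards1; lia.
apply/subset_leq_card/subsetP => a'; rewrite in_set => /existsP[b' /eqP E'].
rewrite [a']surjective_pairing in_setX in_setT andbT; have : z a'.1 != x a'.1.
  apply: contraNneq zx; rewrite -E' !ffunE eqxx.
  have [ab|_] := eqVneq a'.1 b'.1; last first.
    by move/eqP; rewrite (negPf (shift_neq _ _)).
  move=> Ex; apply/eqP/ffunP => k; rewrite !ffunE -ab.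
  by have [->|//] := eqVneq k a'.1.
by apply: contraR; rewrite in_set2 negb_or -E !ffunE => /andP[/negPf-> /negPf->].
Qed.

(** The projection along [i], kept inside the torus by a dummy [i]-th coordinate. *)
Definition pin i x : torus := [ffun k => if k == i then ord_max else x k].

(** The last point of [S] on each line parallel to [i] is an exit; as [S] avoids [ord_max], the
    cyclic shift does not wrap around there. *)
Lemma projection_exits (S : {set torus}) i :
  (forall x, x \in S -> x i != ord_max) ->
  #|pin i @: S| <= #|[set x in S | tact x (i, true) \notin S]|.
Proof.
move=> Smax; set X := [set x in S | _].
apply: leq_trans (leq_imset_card (pin i) X); apply/subset_leq_card/subsetP.
move=> _ /imsetP[x xS ->].
have [y /andP[yS /eqP yx] ymax] := @arg_maxnP _ x
  (fun y => (y \in S) && (pin i y == pin i x)) (fun y => y i) (introT andP (conj xS (eqxx _))).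
apply/imsetP; exists y => //; rewrite in_set yS; apply/negP => aS.
have := ymax (tact y (i, true)); rewrite aS -yx; have -> : pin i (tact y (i, true)) = pin i y.
  by apply/ffunP => k; rewrite !ffunE /=; case: eqP.
rewrite eqxx ffunE eqxx /shift => /(_ isT).
by rewrite ordSE (negPf (Smax y yS)); lia.
Qed.

Lemma projections_prod (S : {set torus}) i j : i != j ->
  #|S| <= #|pin i @: S| * #|pin j @: S|.
Proof.
move=> ij; rewrite -cardsX.
have inj : injective (fun x => (pin i x, pin j x)).
  move=> x y [/ffunP Ei /ffunP Ej]; apply/ffunP => k.
  have := Ei k; have := Ej k; rewrite !ffunE; case: eqP => // -> _.
  by rewrite eq_sym (negPf ij).
rewrite -(card_imset _ inj); apply/subset_leq_card/subsetP => _ /imsetP[x xS ->].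
by rewrite in_setX !imset_f.
Qed.

(** Two projections have product at least |S|, so at most one has fewer than [k] points; each of the
    others gives [k] exits. *)
Lemma boundary_lower_bound (S : {set torus}) (k : nat) :
    (forall x i, x \in S -> x i != ord_max) -> k ^ 2 <= #|S| ->
  d.-1 * k <= \sum_(x in S) #|[set a | tact x a \in ~: S]|.
Proof.
move=> Smax kS.
have le1 : \sum_i #|pin i @: S| <= \sum_(x in S) #|[set a | tact x a \in ~: S]|.
  apply: leq_trans (_ : \sum_i #|[set x in S | tact x (i, true) \notin S]| <= _).
    by apply: leq_sum => i _; apply: projection_exits => x; apply: Smax.
  under eq_bigr => i _ do rewrite -sum1dep_card big_mkcondr /=.
  rewrite exchange_big /=; apply: leq_sum => x _; rewrite -big_mkcond sum1dep_card.
  rewrite -(card_imset _ (_ : injective (fun i : 'I_d => (i, true)))).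
    apply/subset_leq_card/subsetP => _ /imsetP[i + ->].
    by rewrite !in_set.
  by move=> i j [].
apply: leq_trans le1.
have [/forallP all|] := boolP [forall i, k <= #|pin i @: S|].
  apply: leq_trans (_ : d * k <= _); first by rewrite leq_mul2r leq_pred orbT.
  by rewrite -[in X in X <= _](card_ord d) -sum_nat_const; apply: leq_sum.
rewrite negb_forall => /existsP[i0]; rewrite -ltnNge => lt0.
rewrite (bigD1 i0) //=; apply: leq_trans (leq_addl _ _).
apply: leq_trans (_ : \sum_(i | i != i0) k <= _).
  by rewrite sum_nat_const cardC1 card_ord.
apply: leq_sum => i ii0; rewrite leqNgt; apply/negP => lti.
have := leq_trans kS (projections_prod S ii0); rewrite leqNgt => /negP[].
by rewrite -mulnn ltn_mul.
Qed.

End Torus.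

(** * The box inside the torus *)

Section Embedding.
Variables (d n : nat).
Implicit Types (u v w : vertex d n) (t : torus d n) (a : dir d).

Definition emb v : torus d n := [ffun k => widen_ord (leqnSn _) (v k)].

Definition unemb t : vertex d n := [ffun k => inord (t k)].

Lemma embK : cancel emb unemb.
Proof. by move=> v; apply/ffunP => k; rewrite !ffunE; apply: val_inj; rewrite /= inordK. Qed.

Lemma emb_inj : injective emb. Proof. exact: can_inj embK. Qed.

Lemma emb_val v k : emb v k = v k :> nat. Proof. by rewrite ffunE. Qed.

Lemma emb_max v k : emb v k != ord_max.
Proof. by rewrite -val_eqE /= emb_val neq_ltn ltn_ord. Qed.

Lemma unembK t : (forall k, t k != ord_max) -> emb (unemb t) = t.
Proof.
move=> tm; apply/ffunP => k; apply: val_inj; rewrite !ffunE /= inordK //.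
by have := tm k; have := ltn_ord (t k); rewrite -val_eqE /=; lia.
Qed.

Lemma adjE u v : adj u v = (\sum_i `|u i - v i|%N == 1)%N.
Proof.
rewrite /adj -(eqr_nat int) natr_sum; congr (_ == _); apply: eq_bigr => i _.
by rewrite /coordZ natz abszE; congr (`|_|%R); lia.
Qed.

Lemma adj_sym : symmetric (@adj d n).
Proof.
by move=> u v; rewrite !adjE; congr (_ == _); apply: eq_bigr => i _; rewrite distnC.
Qed.

Lemma adjP u v :
  reflect (exists a, tact (emb u) a = emb v) (adj u v).
Proof.
rewrite adjE; apply: (iffP idP) => [/eqP E|[a E]]; last first.
  rewrite (bigD1 a.1) //= big1 => [|k /negPf nk]; last first.
    have := congr1 (fun t : torus d n => (t k : nat)) E.
    by rewrite ffunE nk !emb_val => ->; rewrite distnn.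
  have := congr1 (fun t : torus d n => t a.1) E; rewrite ffunE eqxx /shift.
  have := emb_max u a.1; have := emb_max v a.1; case: a.2 => vm um Ea.
    have := ordSE (emb u a.1); rewrite (negPf um) Ea !emb_val => ->.
    by rewrite addn0 distnS.
  have := ordSE (emb v a.1); rewrite (negPf vm) -Ea ord_predK !emb_val Ea emb_val => ->.
  by rewrite addn0 distSn.
have [i ui] : exists i, u i != v i.
  apply/existsP; rewrite -negb_forall; apply: contra_eqN E => /forallP uv.
  by rewrite big1 // => i _; rewrite (eqP (uv i)) distnn.
have uk k : k != i -> u k = v k.
  move=> ki; apply/val_inj/eqP; rewrite -distn_eq0; move: E.
  rewrite (bigD1 i) //= (bigD1 k) //=; move: ui; rewrite -val_eqE -distn_eq0 /=.
  by set x := `|_ - _|%N; set y := `|_ - _|%N; lia.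
have d1 : `|u i - v i|%N = 1%N.
  by move: E; rewrite (bigD1 i) //= big1 ?addn0 // => k /uk ->; rewrite distnn.
exists (i, (u i < v i)%N); apply/ffunP => k; rewrite ffunE /=.
have [->|/uk ki] := eqVneq k i; last by rewrite !ffunE ki.
rewrite /shift; case: ltnP => uv.
  by apply: ord_inj; rewrite ordSE (negPf (emb_max u i)) !emb_val; lia.
apply: (can_inj (@ordSK _)); rewrite ord_predK; apply: ord_inj.
by rewrite ordSE (negPf (emb_max v i)) !emb_val; lia.
Qed.

Lemma tev_emb v : tev (emb v) = even_vertex v.
Proof.
rewrite /tev /even_vertex -dvdn2 (eq_bigr (fun k => v k : nat)) => [|k _]; last first.
  by rewrite emb_val.
have -> : (\sum_(i < d) coordZ v i = (\sum_i v i)%N%:Z - (d * n)%N%:Z)%R.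
  rewrite sumrB sumr_const card_ord -mulr_natr natz -PoszM mulnC.
  by rewrite (big_morph Posz PoszD (erefl _)).
rewrite dvdn2 dvdzE /= dvdn2; set p := (\sum_i _)%N; set q := (d * n)%N; lia.
Qed.

Lemma boundaryP v :
  reflect (exists i, (v i : nat) = 0%N \/ (v i : nat) = n.*2) (v \in boundary).
Proof.
rewrite inE negb_forall; apply: (iffP existsP) => -[i vi]; exists i.
  by have := ltn_ord (v i); move: vi; rewrite /coordZ; lia.
by have := ltn_ord (v i); move: vi; rewrite /coordZ; lia.
Qed.

Lemma interior_shift v a : v \notin boundary -> exists w, tact (emb v) a = emb w.
Proof.
move=> vb; exists (unemb (tact (emb v) a)); rewrite unembK // => k.
rewrite ffunE; case: ifP => _; last exact: emb_max.
have [v0 v2] : ((v k : nat) <> 0 /\ (v k : nat) <> n.*2)%N.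
  by split=> E; case/negP: vb; apply/boundaryP; exists k; [left|right].
rewrite /shift; case: a.2; apply/eqP.
  by move/(congr1 (@nat_of_ord _)); rewrite ordSE (negPf (emb_max v k)) emb_val => -[].
move/(congr1 (@ordS _)); rewrite ord_predK => /(congr1 (@nat_of_ord _)).
by rewrite ordSE eqxx emb_val.
Qed.

Lemma boundary_exit v : v \in boundary ->
  exists a, forall w, tact (emb v) a <> emb w.
Proof.
move=> /boundaryP[i vi].
have [b hb] : exists b, shift b (emb v i) = ord_max.
  case: vi => vi; [exists false|exists true].
    apply: (can_inj (@ordSK _)); rewrite ord_predK; apply: ord_inj.
    by rewrite ordSE eqxx emb_val.
  by apply: ord_inj; rewrite ordSE (negPf (emb_max v i)) emb_val vi.
exists (i, b) => // w /(congr1 (fun t : torus d n => t i)); rewrite ffunE eqxx hb.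
by move=> E; have := emb_max w i; rewrite -E eqxx.
Qed.

End Embedding.

(** * Minimal cutsets *)

Section MinimalCut.
Variables (d n : nat) (x : vertex d n) (G : {set {set vertex d n}}).
Implicit Types (u v w a b c : vertex d n) (t : torus d n) (k : dir d).
Hypothesis n_gt0 : 0 < n.

Lemma adj_minus_sym : symmetric (adj_minus G).
Proof. by move=> u v; rewrite /adj_minus adj_sym setUC. Qed.

Lemma adj_minus_connect_sym : connect_sym (adj_minus G).
Proof. exact: sym_connect_sym adj_minus_sym. Qed.

(** The two pairs are the first and the last edge of [G] along the path. *)
Lemma path_cut_edges u p : path adj u p -> has (mem G) (path_edges u p) ->
  (exists a b, [/\ connect (adj_minus G) u a, adj a b,
     [set a; b] \in path_edges u p & [set a; b] \in G]) /\
  (exists a b, [/\ connect (adj_minus G) b (last u p), adj a b,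
     [set a; b] \in path_edges u p & [set a; b] \in G]).
Proof.
have free v q : path adj v q -> ~~ has (mem G) (path_edges v q) ->
    connect (adj_minus G) v (last v q).
  elim: q v => [|w q IH] v //= /andP[vw pq]; rewrite negb_or => /andP[vG hq].
  by apply: connect_trans (IH _ pq hq); apply: connect1; rewrite /adj_minus vw.
elim: p u => //= v p IH u /andP[uv pp].
have [uG _|uG /= hp] := boolP ([set u; v] \in G).
  split; first by exists u, v; rewrite inE eqxx.
  have [/(IH v pp) [_ [a [b [cb ab be bG]]]]|np] := boolP (has (mem G) (path_edges v p)).
    by exists a, b; rewrite inE be orbT.
  by exists u, v; rewrite inE eqxx; split=> //; apply: free.
have uv1 : connect (adj_minus G) u v by apply: connect1; rewrite /adj_minus uv.
have [[a [b [cb ab be bG]]] [a' [b' [cb' ab' be' bG']]]] := IH v pp hp.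
split; first by exists a, b; rewrite inE be orbT; split=> //; apply: connect_trans cb.
by exists a', b'; rewrite inE be' orbT.
Qed.

Hypothesis MC : MCut x G.

Lemma A1_boundary v : v \in A1 x G -> v \notin boundary.
Proof.
rewrite inE => /connectP[p0 pp0 ->]; case/shortenP: pp0 => p pp up _.
apply/negP => pB; case: MC => _ /(_ p) sep _.
have sub : subrel (adj_minus G) adj by move=> a b /andP[].
have [e eE eG] := sep (sub_path sub pp) up pB.
elim: p x pp eE {sep up pB p0} => //= w p IH y /andP[/andP[_ yw] pp].
by rewrite inE => /orP[/eqP E|]; [rewrite -E eG in yw|apply: IH].
Qed.

Lemma A1_step u v : u \in A1 x G -> adj u v -> v \notin A1 x G -> [set u; v] \in G.
Proof.
rewrite !inE => xu uv; apply: contraR => uG; apply: connect_trans xu _.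
by apply: connect1; rewrite /adj_minus uv.
Qed.

Lemma A1_connect u v : connect (adj_minus G) u v -> (u \in A1 x G) = (v \in A1 x G).
Proof.
by move=> uv; rewrite !inE; apply: same_connect_r => //; exact: adj_minus_connect_sym.
Qed.

(** By minimality some path to the boundary meets [G] only in [e]. Its first and last cut edges are
    both [e], which therefore joins the component of [x] to a component meeting the boundary. *)
Lemma cut_edge e : e \in G -> exists a b c,
  [/\ e = [set a; b], adj a b, a \in A1 x G, b \notin A1 x G &
    (c \in boundary) && connect (adj_minus G) b c].
Proof.
move=> eG; suff : [exists a, exists b, exists c, [&& e == [set a; b], adj a b,
    a \in A1 x G, b \notin A1 x G & (c \in boundary) && connect (adj_minus G) b c]].
  move=> /existsP[a /existsP[b /existsP[c /and5P[/eqP ? ? ? ? ?]]]].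
  by exists a, b, c.
apply: contraT => nQ; case: MC => _ sep /(_ (G :\ e)) [].
  exact: properD1.
move=> p pp up pB; have [e1 e1p e1G] := sep p pp up pB.
have hp : has (mem G) (path_edges x p) by apply/hasP; exists e1.
have [[a [b [xa ab abp abG]]] [a' [b' [b'c ab' abp' abG']]]] := path_cut_edges pp hp.
have [Ee|ne] := eqVneq [set a; b] e; last by exists [set a; b]; rewrite // !inE ne.
have [Ee'|ne] := eqVneq [set a'; b'] e; last by exists [set a'; b']; rewrite // !inE ne.
case/negP: nQ; apply/existsP; exists a; apply/existsP; exists b.
apply/existsP; exists (last x p); rewrite Ee eqxx ab inE xa pB /=.
have Eb : b' = b.
  have : b' \in [set a; b] by rewrite Ee -Ee' !inE eqxx orbT.
  rewrite !inE => /orP[/eqP E|/eqP//].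
  have : last x p \in A1 x G by rewrite -(A1_connect b'c) E inE.
  by move/A1_boundary; rewrite pB.
rewrite -Eb b'c andbT (A1_connect b'c); apply/negP => /A1_boundary.
by rewrite pB.
Qed.

Lemma cut_pair u v : [set u; v] \in G -> adj u v ->
  (u \in A1 x G) = ~~ (v \in A1 x G).
Proof.
move=> uG uv; have [a [b [c [E _ aA bA _]]]] := cut_edge uG.
have uab : u \in [set a; b] by rewrite -E !inE eqxx.
have vab : v \in [set a; b] by rewrite -E !inE eqxx orbT.
have uNv : u != v.
  by apply: contraTneq uv => ->; rewrite adjE big1 // => i _; rewrite distnn.
move: uab vab uNv; rewrite !in_set2 => /orP[/eqP->|/eqP->] /orP[/eqP->|/eqP->];
  by rewrite ?eqxx ?aA ?(negPf bA).
Qed.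

Lemma card_cut_sum (X : {set vertex d n}) : X \subset A1 x G ->
  #|[set e in G | [exists v in X, v \in e]]| = \sum_(v in X) P G v.
Proof.
move=> XA; rewrite -sum1_card /P.
transitivity (\sum_(e in G) \sum_(v in X) (v \in e) : nat).
  rewrite big_mkcond [RHS]big_mkcond; apply: eq_bigr => e _; rewrite in_set.
  have [eG|//] := boolP (e \in G).
  have [a [b [c [-> ab aA bA _]]]] := cut_edge eG.
  have vE v : v \in X -> (v \in [set a; b]) = (v == a).
    move=> vX; rewrite in_set2; have [->|_] /= := eqVneq v a; first by [].
    by apply: contraNF bA => /eqP <-; apply: (subsetP XA).
  rewrite (eq_bigr (fun v => (v == a) : nat)) => [|v vX]; last by rewrite vE.
  rewrite -big_mkcondr sum1dep_card /=; have [aX|aX] := boolP (a \in X).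
    have -> : [exists v in X, v \in [set a; b]].
      by apply/existsP; exists a; rewrite aX in_set2 eqxx.
    rewrite -(cards1 a); apply/esym; apply: eq_card => v; rewrite !inE.
    by have [->|] := eqVneq v a; rewrite ?aX ?andbF.
  have -> : [exists v in X, v \in [set a; b]] = false.
    apply/negbTE; rewrite negb_exists; apply/forallP => v.
    apply/negP => /andP[vX]; rewrite vE // => /eqP E.
    by rewrite -E vX in aX.
  symmetry; apply/eqP; rewrite cards_eq0 -subset0; apply/subsetP => v.
  by rewrite !inE => /andP[vX /eqP E]; rewrite -E vX in aX.
rewrite exchange_big /=; apply: eq_bigr => v _.
by rewrite -big_mkcondr sum1dep_card.
Qed.

Lemma card_cut : #|G| = \sum_(v in A1 x G) P G v.
Proof.
rewrite -card_cut_sum //; apply: eq_card => e; rewrite inE.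
have [eG|//] := boolP (e \in G); have [a [b [c [-> _ aA _ _]]]] := cut_edge eG.
by symmetry; apply/existsP; exists a; rewrite aA in_set2 eqxx.
Qed.

Definition inner : {set torus d n} := @emb d n @: A1 x G.

Lemma mem_inner v : (emb v \in inner) = (v \in A1 x G).
Proof. by rewrite mem_imset //; exact: emb_inj. Qed.

Lemma innerP t : t \in inner -> exists2 v, v \in A1 x G & t = emb v.
Proof. by move=> /imsetP[v vA ->]; exists v. Qed.

(** A_1 avoids the boundary of the box, so its torus neighbours are neighbours in the box and torus
    exits are exactly cut edges. *)
Lemma deg_inner v : v \in A1 x G -> deg (@tact d n) (emb v) (~: inner) = P G v.
Proof.
move=> vA; have vB := A1_boundary vA.
pose f k := [set v; unemb (tact (emb v) k)].
have fE k : exists w, [/\ tact (emb v) k = emb w, f k = [set v; w] & adj v w].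
  have [w E] := interior_shift k vB; exists w; rewrite /f E embK; split=> //.
  by apply/adjP; exists k.
have adj_neq w : adj v w -> (w == v) = false.
  by apply: contraTF => /eqP->; rewrite adjE big1 // => i _; rewrite distnn.
have f_inj : injective f.
  move=> k l; have [w [Ek fk vw]] := fE k; have [w' [El fl _]] := fE l.
  rewrite fk fl => E; have : w \in [set v; w'] by rewrite -E in_set2 eqxx orbT.
  rewrite in_set2 adj_neq //= => /eqP Ew.
  by apply: (@tact_inj d n n_gt0 (emb v)); rewrite Ek El Ew.
rewrite /deg -(card_imset _ f_inj) /P; apply: eq_card => e.
rewrite [in RHS]inE; apply/imsetP/andP => [[k]|[eG ve]].
  rewrite inE in_setC; have [w [-> -> vw]] := fE k; rewrite mem_inner => wA ->.
  by rewrite in_set2 eqxx /=; split=> //; apply: A1_step.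
have [a [b [c [E ab aA bA _]]]] := cut_edge eG.
have va : v = a.
  by move: ve; rewrite E in_set2 => /orP[/eqP//|/eqP vb]; rewrite -vb vA in bA.
have [k Ek] : exists k, tact (emb v) k = emb b by apply/adjP; rewrite va.
exists k; first by rewrite inE in_setC Ek mem_inner.
by rewrite /f Ek embK E va.
Qed.

Lemma sum_inner (f : torus d n -> nat) (X : {set vertex d n}) :
  \sum_(t in @emb d n @: X) f t = \sum_(v in X) f (emb v).
Proof. by rewrite big_imset //= => u v _ _; apply: emb_inj. Qed.

Lemma inner_max t : t \in inner -> forall i, t i != ord_max.
Proof. by move=> /innerP[v _ ->] i; apply: emb_max. Qed.

Hypothesis d_gt0 : 0 < d.
Hypothesis x_even : even_vertex x.
Hypothesis odd_cut : forall v, v \in E1 x G -> odd_vertex v.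

Lemma inner_even t k : t \in inner -> tev t -> tact t k \in inner.
Proof.
move=> /innerP[v vA ->]; rewrite tev_emb => ve.
have [w Ew] := interior_shift k (A1_boundary vA); rewrite Ew mem_inner.
apply: contraLR ve => wA; apply: odd_cut; rewrite inE vA /=.
have vw : adj v w by apply/adjP; exists k.
apply/card_gt0P; exists [set v; w]; rewrite inE in_set2 eqxx andbT.
exact: A1_step.
Qed.

Notation todds := (odds (@tev d n) inner).
Notation touts := (outs (@tact d n) (@tev d n) inner).

Lemma x_inner : emb x \in inner.
Proof. by rewrite mem_inner inE. Qed.

Lemma inner_odd t : t \in todds -> 0 < deg (@tact d n) t inner.
Proof.
rewrite inE => /andP[/innerP[v vA ->]]; rewrite tev_emb => vo.
move: vA; rewrite inE adj_minus_connect_sym => /connectP[[|w p]] /=.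
  by move=> _ E; move: vo; rewrite -E x_even.
move=> /andP[/andP[vw vwG] pp] E; apply/deg_gt0P.
have [k Ek] := adjP _ _ vw; exists k; rewrite Ek mem_inner inE.
by rewrite adj_minus_connect_sym; apply/connectP; exists p.
Qed.

Lemma outsP t : t \in touts -> exists v w,
  [/\ t = emb w, v \in A1 x G, w \notin A1 x G, adj v w & [set v; w] \in G].
Proof.
rewrite !inE => /and3P[tN te /deg_gt0P[k /innerP[v vA Ev]]].
have Et : t = tact (emb v) (topp k) by rewrite -Ev tactK.
have [w Ew] := interior_shift (topp k) (A1_boundary vA).
exists v, w; rewrite Et Ew; move: tN; rewrite Et Ew mem_inner => wA.
have vw : adj v w by apply/adjP; exists (topp k).
by split=> //; apply: A1_step.
Qed.

Lemma cut_out_boundary v w : v \in A1 x G -> w \notin A1 x G -> [set v; w] \in G ->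
  exists2 c, c \in boundary & connect (adj_minus G) w c.
Proof.
move=> vA wA /cut_edge[a [b [c [E ab aA bA /andP[cB bc]]]]]; exists c => //.
suff -> : w = b by [].
have : w \in [set a; b] by rewrite -E in_set2 eqxx orbT.
by rewrite in_set2 => /orP[/eqP wa|/eqP//]; rewrite wa aA in wA.
Qed.

(** A boundary vertex can leave the box. Any other outer vertex starts a path to the boundary that
    avoids [G], and its first step stays outside A_1. *)
Lemma outs_exit t : t \in touts -> 0 < deg (@tact d n) t (~: inner).
Proof.
move=> /outsP[v [w [-> vA wA vw vwG]]]; apply/deg_gt0P.
have [wB|wB] := boolP (w \in boundary).
  have [k kN] := boundary_exit wB; exists k; rewrite in_setC.
  by apply/negP => /innerP[u _ /kN].
have [c cB wc] := cut_out_boundary vA wA vwG.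
move: wc => /connectP[[|u p]] /=; first by move=> _ E; rewrite -E cB in wB.
move=> /andP[/andP[wu wuG] _] _; have [k Ek] := adjP _ _ wu.
exists k; rewrite Ek in_setC mem_inner; apply: contra wA => uA.
apply: contraR wuG => wA; rewrite setUC; apply: A1_step => //.
by rewrite adj_sym.
Qed.

Lemma outs_max t : t \in touts -> forall i, t i != ord_max.
Proof. by move=> /outsP[v [w [-> _ _ _ _]]] i; apply: emb_max. Qed.

Lemma degL : \sum_(t in todds) deg (@tact d n) t (~: inner) = #|G|.
Proof.
rewrite card_cut; transitivity (\sum_(t in inner) deg (@tact d n) t (~: inner)).
  rewrite big_mkcond [RHS]big_mkcond; apply: eq_bigr => t _; rewrite inE.
  have [tA|//] := boolP (t \in inner); have [te|//] := boolP (tev t).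
  symmetry; apply/eqP; rewrite cards_eq0 -subset0; apply/subsetP => k.
  by rewrite inE in_setC inner_even.
by rewrite sum_inner; apply: eq_bigr => v vA; rewrite deg_inner.
Qed.

Section Rough.
Variables (R : realType) (k0 : nat).
Hypothesis k0_d : k0 ^ 2 <= d < k0.+1 ^ 2.

(** For a natural number q, sqrt d < q means k0 < q; so P >= 2d - sqrt d says that at most [k0]
    neighbours lie in A_1. *)
Lemma roughE : rough (@tact d n) (@tev d n) inner k0 =
  @emb d n @: (E1 x G :\: E1e R x G).
Proof.
have sq q : (Num.sqrt d%:R < q%:R :> R)%R = (k0 < q).
  have [->|q0] := posnP q; first by rewrite ltn0 ltNge sqrtr_ge0.
  rewrite -[q%:R%R]ger0_norm ?ler0n // -sqrtr_sqr ltr_sqrt; last first.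
    by rewrite exprn_gt0 // ltr0n.
  rewrite -natrX ltr_nat; case/andP: k0_d => lo hi.
  apply/idP/idP => [dq|kq]; last by apply: leq_trans hi _; rewrite leq_exp2r.
  by rewrite -(ltn_exp2r _ _ (isT : 0 < 2)); apply: leq_ltn_trans lo dq.
have mem v : v \in A1 x G ->
    (emb v \in rough (@tact d n) (@tev d n) inner k0) = (v \in E1 x G :\: E1e R x G).
  move=> vA; rewrite in_setD /rough !in_set tev_emb mem_inner vA /= deg_inner //.
  have [P0|P0] := posnP (P G v); first by rewrite !andbF.
  rewrite -/(odd_vertex v) odd_cut ?andbT /=; last by rewrite inE vA P0.
  have xv : connect (adj_minus G) x v by move: vA; rewrite inE.
  rewrite -sq xv andbT /= -ltNge; have := degC (@tact d n) (card_dir d) (emb v) inner.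
  rewrite deg_inner // => E.
  have -> : ((P G v)%:R = 2 * d%:R - (deg (@tact d n) (emb v) inner)%:R :> R)%R.
    by rewrite -natrM -E natrD addrC addKr.
  by rewrite ltrD2l ltrN2.
apply/setP => t; apply/idP/imsetP => [tr|[v vE ->]].
  have /innerP[v vA Et] : t \in inner.
    by move: tr; rewrite inE => /andP[]; rewrite inE => /andP[].
  by exists v; rewrite // -mem // -Et.
by rewrite mem //; move: vE; rewrite !inE => /and3P[_ ->].
Qed.

Lemma rough_sum :
  \sum_(t in rough (@tact d n) (@tev d n) inner k0) deg (@tact d n) t (~: inner) =
  #|cut_r R x G|.
Proof.
have sub : E1 x G :\: E1e R x G \subset A1 x G.
  by apply/subsetP => v; rewrite !inE => /and3P[_ ->].
rewrite roughE sum_inner card_cut_sum //; apply: eq_bigr => v vE.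
by rewrite deg_inner // (subsetP sub).
Qed.

End Rough.
End MinimalCut.

(** * Connectivity of the boundary of the box, and potentials on its edges *)

Section Box.
Variables (d n : nat).
Implicit Types (u v w : vertex d n) (i j k : 'I_d).

Definition setc v k (t : nat) : vertex d n :=
  [ffun j => if j == k then inord t else v j].

Lemma setc_id v k : setc v k (v k) = v.
Proof. by apply/ffunP => j; rewrite ffunE; case: eqP => // ->; rewrite inord_val. Qed.

Lemma setc_eq v k t : t <= n.*2 -> setc v k t k = t :> nat.
Proof. by move=> tn; rewrite ffunE eqxx inordK. Qed.

Lemma setc_neq v k j t : j != k -> setc v k t j = v j.
Proof. by rewrite ffunE => /negPf->. Qed.

Lemma adj_coord u v : reflect
  (exists2 k, forall j, j != k -> u j = v j &
     (v k = (u k).+1 :> nat) \/ (u k = (v k).+1 :> nat)) (adj u v).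
Proof.
rewrite adjE; apply: (iffP idP) => [/eqP E|[k uv uk]]; last first.
  rewrite (bigD1 k) //= big1 => [|j /uv ->]; last by rewrite distnn.
  by case: uk => ->; rewrite ?distnS ?distSn.
have [k uk] : exists k, u k != v k.
  apply/existsP; rewrite -negb_forall; apply: contra_eqN E => /forallP uv.
  by rewrite big1 // => k _; rewrite (eqP (uv k)) distnn.
exists k => [j jk|].
  apply/val_inj/eqP; rewrite -distn_eq0; move: E.
  rewrite (bigD1 k) //= (bigD1 j) //=; move: uk; rewrite -val_eqE -distn_eq0 /=.
  by set a := `|_ - _|%N; set b := `|_ - _|%N; lia.
by move: E uk; rewrite (bigD1 k) //= -val_eqE /=; lia.
Qed.

Lemma adj_setc v k t : t < n.*2 -> adj (setc v k t) (setc v k t.+1).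
Proof.
move=> tn; apply/adj_coord; exists k => [j jk|]; first by rewrite !setc_neq.
by left; rewrite !setc_eq // ltnW.
Qed.

(** An extreme coordinate [j] keeps the vertex on the boundary while the others are moved to 0; then
    another coordinate, now 0, does so while [j] is moved. *)
Lemma boundary_connected (r : rel (vertex d n)) : 1 < d -> symmetric r ->
    (forall u v, u \in boundary -> v \in boundary -> adj u v -> r u v) ->
  forall u v, u \in boundary -> v \in boundary -> connect r u v.
Proof.
move=> d1 rs rB.
have cs : connect_sym r := sym_connect_sym rs.
pose extreme v j := (v j : nat) = 0 \/ (v j : nat) = n.*2.
have line v j k t : j != k -> extreme v j -> t <= n.*2 ->
    connect r (setc v k 0) (setc v k t).
  move=> jk vj; have inB c : setc v k c \in boundary.
    by apply/boundaryP; exists j; rewrite setc_neq.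
  elim: t => // t IH tn; apply: connect_trans (IH (ltnW tn)) _.
  by apply/connect1/rB => //; apply: adj_setc.
have kill v j k : j != k -> extreme v j -> connect r v (setc v k 0).
  move=> jk vj; rewrite cs -{2}(setc_id v k); apply: line jk vj _.
  by rewrite -ltnS ltn_ord.
pose zero (s : seq 'I_d) v : vertex d n := [ffun j => if j \in s then inord 0 else v j].
have zeroS v j s : j \notin s -> extreme v j -> connect r v (zero s v).
  elim: s => [|k s IH]; first by move=> _ _; rewrite (_ : zero _ _ = v) //; apply/ffunP => i; rewrite ffunE.
  rewrite inE negb_or => /andP[jk js] vj; apply: connect_trans (IH js vj) _.
  have -> : zero (k :: s) v = setc (zero s v) k 0.
    by apply/ffunP => i; rewrite !ffunE inE; case: eqP.
  by apply: kill jk _; rewrite /extreme ffunE (negPf js).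
pose corner : vertex d n := [ffun => inord 0].
have toC v : v \in boundary -> connect r v corner.
  move=> /boundaryP[j vj].
  have [k jk] : exists k, j != k.
    have [j0|j0] := eqVneq (val j) 0.
      by exists (Ordinal d1); rewrite -val_eqE j0.
    by exists (Ordinal (ltnW d1)); rewrite -val_eqE.
  apply: connect_trans (zeroS v j [seq i <- enum 'I_d | i != j] _ vj) _.
    by rewrite mem_filter eqxx.
  have -> : corner = setc (zero [seq i <- enum 'I_d | i != j] v) j 0.
    apply/ffunP => i; rewrite !ffunE mem_filter mem_enum andbT.
    by case: eqP.
  apply: (kill _ k); first by rewrite eq_sym.
  left; rewrite ffunE mem_filter mem_enum eq_sym jk /=.
  by rewrite inordK.
by move=> u v /toC uc /toC; rewrite cs; apply: connect_trans.
Qed.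

(* Parity of the number of marked edges crossed is a potential as soon as every
   unit square carries an even number of them. *)
Lemma square_potential (g : rel (vertex d n)) : symmetric g ->
    (forall a b c e, adj a b -> adj b c -> adj c e -> adj e a ->
       g a b (+) g b c (+) g c e (+) g e a = false) ->
  exists f : vertex d n -> bool, forall u v, adj u v -> g u v = f u (+) f v.
Proof.
move=> gs sq.
suff ind m : m <= d -> exists f : vertex d n -> bool, forall u v k, k < m ->
    (forall j, j != k -> u j = v j) -> v k = (u k).+1 :> nat -> g u v = f u (+) f v.
  have [f fP] := ind d (leqnn d); exists f => u v /adj_coord[k uv [vk|uk]].
    exact: fP uv vk.
  rewrite gs addbC; apply: (fP v u k) => // j jk; by rewrite uv.
elim: m => [_|m IH md]; first by exists (fun=> false).
have [f fP] := IH (ltnW md); pose k := Ordinal md.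
pose l v t := \big[addb/false]_(s < t) g (setc v k s) (setc v k s.+1).
have lS v t : l v t.+1 = l v t (+) g (setc v k t) (setc v k t.+1).
  by rewrite /l big_ord_recr.
(* Take the earlier potential on the face where coordinate [k] is 0 and sum [g] along axis [k] from
   there; [tele] compares parallel lines square by square. *)
exists (fun v => f (setc v k 0) (+) l v (v k)) => u v i; rewrite ltnS leq_eqVlt.
case/orP => [/eqP im|im] uv vi.
  have Ei : i = k by apply: val_inj.
  rewrite {i im}Ei in uv vi; have E s : setc u k s = setc v k s.
    apply/ffunP => j; rewrite !ffunE; case: eqP => // /eqP jk; exact: uv.
  have El t : l u t = l v t by apply: eq_bigr => s _; rewrite !E.
  rewrite E El vi lS -vi setc_id.
  have -> : setc v k (u k) = u by rewrite -E setc_id.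
  by move: (f _) (l _ _) (g _ _) => [] [] [].
have ik : i != k by apply: contraTneq im => ->; rewrite /= ltnn.
have ukv : u k = v k by apply: uv; rewrite eq_sym.
have uvt t : (forall j, j != i -> setc u k t j = setc v k t j).
  by move=> j ji; rewrite !ffunE; case: eqP => // _; apply: uv.
have adjt t : adj (setc u k t) (setc v k t).
  by apply/adj_coord; exists i; [apply: uvt|left; rewrite !setc_neq].
have tele t : t <= n.*2 -> l u t (+) l v t =
    g (setc u k 0) (setc v k 0) (+) g (setc u k t) (setc v k t).
  elim: t => [|t IHt] tn; first by rewrite /l !big_ord0 /= addbb.
  rewrite !lS.
  have := sq _ _ _ _ (adj_setc u k tn) (adjt t.+1) (etrans (adj_sym _ _) (adj_setc v k tn))
    (etrans (adj_sym _ _) (adjt t)).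
  rewrite (gs (setc v k t.+1) (setc v k t)) (gs (setc v k t) (setc u k t)).
  have := IHt (ltnW tn); move: (l u t) (l v t) (g _ _) (g _ _) (g _ _) (g _ _) (g _ _).
  by move=> [] [] [] [] [] [] [].
have f0 : g (setc u k 0) (setc v k 0) = f (setc u k 0) (+) f (setc v k 0).
  by apply: (fP _ _ i im (uvt 0)); rewrite !setc_neq.
have Ev : setc v k (u k) = v by rewrite ukv setc_id.
have := tele (u k) (leq_ord (u k)); rewrite setc_id Ev f0 -ukv.
have solve (p q r s z : bool) :
    r (+) s = p (+) q (+) z -> z = p (+) r (+) (q (+) s).
  by case: p q r s z => [] [] [] [] [].
exact: solve.
Qed.

End Box.

(** * The outer side of an odd cutset is connected at distance 2 *)

Section CutConnected.
Variables (d n : nat) (x : vertex d n) (G : {set {set vertex d n}}).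
Hypotheses (n_gt0 : 0 < n) (d_gt1 : 1 < d) (MC : MCut x G).
Hypothesis odd_cut : forall v, v \in E1 x G -> odd_vertex v.
Implicit Types (u v w p q r s : vertex d n) (t : torus d n).

Notation inner' := (inner x G).
Notation touts := (outs (@tact d n) (@tev d n) inner').

Lemma even_adj u v : adj u v -> even_vertex v = ~~ even_vertex u.
Proof. by move=> /adjP[k E]; rewrite -!tev_emb -E tev_act. Qed.

Lemma A1_even u v : u \in A1 x G -> even_vertex u -> adj u v -> v \in A1 x G.
Proof.
move=> uA ue /adjP[k E]; rewrite -mem_inner -E.
by apply: inner_even; rewrite ?mem_inner ?tev_emb.
Qed.

Lemma emb_outs u v : adj u v -> u \in A1 x G -> v \notin A1 x G -> emb v \in touts.
Proof.
move=> uv uA vA; rewrite !inE mem_inner vA tev_emb (even_adj uv) /=.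
have [ue|_] := boolP (even_vertex u); first by rewrite (A1_even uA ue uv) in vA.
by apply/deg_gt0P; move: uv; rewrite adj_sym => /adjP[k E]; exists k; rewrite E mem_inner.
Qed.

Lemma emb_near2 p q r : adj p r -> adj r q -> near (@tact d n) 2 (emb p) (emb q).
Proof. by move=> /adjP[k Ek] /adjP[l <-]; rewrite -Ek; apply: near2. Qed.

(* Timar's argument: if the cutset edges could be split into two classes such
   that no unit square meets both, crossing the first class would be a
   potential, contradicting the connectivity of the two sides. *)
Lemma outs_connected (C : {set torus d n}) t t' :
    t \in touts -> t \in C -> t' \in touts -> t' \notin C ->
  exists t1 t2, [/\ t1 \in touts, t1 \in C, t2 \in touts, t2 \notin C &
    near (@tact d n) 2 t1 t2].
Proof.
move=> tO tC t'O t'C.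
suff : [exists t1, exists t2, [&& t1 \in touts, t1 \in C, t2 \in touts,
    t2 \notin C & near (@tact d n) 2 t1 t2]].
  by move=> /existsP[t1 /existsP[t2 /and5P[? ? ? ? ?]]]; exists t1, t2.
apply: contraT => /existsPn nE.
have H t1 t2 : t1 \in touts -> t2 \in touts -> near (@tact d n) 2 t1 t2 ->
    t1 \in C -> t2 \in C.
  move=> t1O t2O t12 t1C; have /existsPn/(_ t2) := nE t1.
  by rewrite t1O t1C t2O t12 andbT negbK.
(* [g] marks the cut edges whose outer end lies in [C]. *)
pose g u v := [&& u \in A1 x G, v \notin A1 x G & emb v \in C] ||
  [&& v \in A1 x G, u \notin A1 x G & emb u \in C].
have gs : symmetric g by move=> u v; rewrite /g orbC.
have gE p r : even_vertex p -> adj p r ->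
    g p r = [&& p \notin A1 x G, emb p \in C & r \in A1 x G].
  move=> pe pr; rewrite /g; have [pA|pA] := boolP (p \in A1 x G).
    by rewrite (A1_even pA pe pr).
  by rewrite /= andbC.
(* If an even corner is in A_1, so are both odd ones, and the two edges at the other even corner
   agree. If neither is, an odd corner in A_1 makes both even corners outer vertices at distance 2,
   which [C] does not separate. *)
have sq p r q s : even_vertex p -> adj p r -> adj r q -> adj q s -> adj s p ->
    g p r (+) g r q (+) g q s (+) g s p = false.
  move=> pe pr rq qs sp; have qe : even_vertex q.
    by rewrite (even_adj rq) (even_adj pr) pe.
  have [qr ps] : adj q r /\ adj p s by rewrite (adj_sym q) (adj_sym p).
  rewrite (gs r q) (gs s p) (gE p r) // (gE q r) // (gE q s) // (gE p s) //.
  have [pA|pA] := boolP (p \in A1 x G).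
    rewrite (A1_even pA pe pr) (A1_even pA pe ps) /=.
    by case: (_ && _).
  have [qA|qA] := boolP (q \in A1 x G).
    rewrite (A1_even qA qe qr) (A1_even qA qe qs) /=.
    by case: (_ && _).
  have CE m : m \in A1 x G -> adj m p -> adj m q -> (emb p \in C) = (emb q \in C).
    move=> mA mp mq; have [pO qO] := (emb_outs mp mA pA, emb_outs mq mA qA).
    apply/idP/idP; apply: H => //; apply: (@emb_near2 _ _ m) => //;
      by rewrite adj_sym.
  have [rA|rA] := boolP (r \in A1 x G).
    by rewrite /= (CE r) 1?adj_sym //; case: (_ \in C) (_ \in A1 x G) => [] [].
  have [sA|sA] := boolP (s \in A1 x G); last by rewrite /= !andbF.
  by rewrite /= (CE s) // 1?adj_sym //; case: (_ \in C).
have [f fP] : exists f : vertex d n -> bool, forall u v, adj u v -> g u v = f u (+) f v.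
  apply: square_potential => // a b c e ab bc ce ea.
  have [ae|ao] := boolP (even_vertex a); first exact: sq.
  have be : even_vertex b by rewrite (even_adj ab) ao.
  have := sq b c e a be bc ce ea ab.
  by case: (g a b) (g b c) (g c e) (g e a) => [] [] [] [].
have fc u v : connect (adj_minus G) u v -> f u = f v.
  move=> /connectP[pp]; elim: pp u => [|w pp IH] u /=; first by move=> _ ->.
  move=> /andP[/andP[uw uwG] pw] Ev; rewrite -(IH w pw Ev).
  have := fP u w uw; have -> : g u w = false.
    apply: contraNF uwG; rewrite /g => /orP[] /and3P[uA wA _].
      exact: A1_step uA uw wA.
    by rewrite setUC; apply: A1_step uA _ wA; rewrite adj_sym.
  by case: (f u) (f w) => [] [].
have key m : m \in touts -> exists c, c \in boundary /\
    (m \in C) = f c (+) f x.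
  move=> /(outsP MC)[v [w [-> vA wA vw vwG]]].
  have [c cB wc] := cut_out_boundary MC vA wA vwG; exists c; split=> //.
  rewrite -(fc _ _ wc) (fc x v); last by rewrite inE in vA.
  by rewrite addbC -(fP _ _ vw) /g vA wA (negPf wA) /= orbF.
have bc u v : u \in boundary -> v \in boundary -> f u = f v.
  move=> uB vB; apply/fc/(boundary_connected d_gt1 (@adj_minus_sym d n G)) => //.
  move=> {uB vB} a b aB bB ab; rewrite /adj_minus ab /=; apply/negP => abG.
  have := cut_pair MC abG ab.
  have nA c : c \in boundary -> (c \in A1 x G) = false.
    by move=> cB; apply: contraTF cB; apply: A1_boundary.
  by rewrite !nA.
have [c [cB Ec]] := key t tO; have [c' [cB' Ec']] := key t' t'O.
by move: t'C; rewrite Ec' (bc c' c) // -Ec tC.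
Qed.

(** The points before the first exit have distinct projections along another axis [j], and each line
    in direction [j] through A_1 contributes a cut edge; so [m] is at most |G|. *)
Lemma ray_hits_outs (i : 'I_d) : even_vertex x -> exists2 m, m <= #|G| &
  iter m (fun t => tact t (i, true)) (emb x) \in touts.
Proof.
move=> xe; pose y m := iter m (fun t => tact t (i, true)) (emb x).
have yS m : y m.+1 = tact (y m) (i, true) by [].
have yi m : (forall l, l < m -> y l \in inner') -> y m i = x i + m :> nat.
  elim: m => [|m IH] hl; first by rewrite /y /= emb_val addn0.
  rewrite yS ffunE eqxx /shift ordSE.
  rewrite (negPf (inner_max (hl m _) i)) // IH ?addnS // => l lm.
  by apply: hl; apply: ltnW.
have exN : exists m, y m \notin inner'.
  case: (boolP [forall l : 'I_n.*2.+2, y l \in inner']) => [/forallP all|].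
    have := ltn_ord (y n.*2.+2 i); rewrite yi => [|l ln]; last exact: (all (Ordinal ln)).
    by rewrite ltnNge leq_addl.
  by rewrite negb_forall => /existsP[l lN]; exists l.
have [m mN mmin] := ex_minnP exN.
have yA l : l < m -> y l \in inner'.
  by move=> lm; apply: contraTT lm => /mmin; rewrite -leqNgt.
have m0 : 0 < m by case: (m) mN => //; rewrite /y /= x_inner.
have predA : y m.-1 \in inner' by apply: yA; rewrite prednK.
have Em : y m = tact (y m.-1) (i, true) by rewrite -yS prednK.
have predo : ~~ tev (y m.-1).
  by apply: contra mN => ye; rewrite Em; apply: inner_even.
exists m; last first.
  rewrite -/(y m) inE in_setC mN Em tev_act predo /=; apply/deg_gt0P.
  by exists (topp (i, true)); rewrite tactK.
have [j ji] : exists j, j != i.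
  have [i0|i0] := eqVneq (val i) 0.
    by exists (Ordinal d_gt1); rewrite -val_eqE /= i0.
  by exists (Ordinal (ltnW d_gt1)); rewrite -val_eqE /= eq_sym.
have inj : injective (fun l : 'I_m => pin j (y l)).
  move=> l l' /ffunP/(_ i)/(congr1 (@nat_of_ord _)).
  rewrite !ffunE eq_sym (negPf ji) !yi.
  - by move/addnI/val_inj.
  - by move=> p pl; apply: yA; apply: ltn_trans pl (ltn_ord _).
  - by move=> p pl; apply: yA; apply: ltn_trans pl (ltn_ord _).
rewrite -[X in X <= _](card_ord m) -(card_imset _ inj).
apply: leq_trans (_ : #|pin j @: inner'| <= _).
  apply/subset_leq_card/subsetP => _ /imsetP[l _ ->].
  by apply: imset_f; apply: yA.
have := @projection_exits d n n_gt0 inner' j (fun t tA => inner_max tA j).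
move/leq_trans; apply.
rewrite -(degL n_gt0 MC odd_cut) -sum1_card big_mkcond [X in _ <= X]big_mkcond.
apply: leq_sum => t _; rewrite inE; case: ifP => // /andP[tA tN].
have to : t \in odds (@tev d n) inner'.
  by rewrite inE tA; apply: contra tN => te; apply: inner_even.
by rewrite to; apply/deg_gt0P; exists (j, true); rewrite in_setC.
Qed.

End CutConnected.

(** * Coding by walks *)

Section Coding.
Variables (d n : nat) (x : vertex d n) (i0 : 'I_d) (q h L K : nat).

(** 18 = 8 + 2 + 8: the radius of the net, a step along O, and the radius again. *)
Definition jump : finType := 18.-tuple (option (dir d)).
Definition marks : finType := {set 'I_6}.

Definition code : finType := ('I_L.+1 * (2 * K).-tuple (jump * marks))%type.

Fixpoint visits (t : torus d n) (s : seq (jump * marks)) : seq (torus d n * marks) :=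
  if s is (m, g) :: s' then
    let t' := walk (@tact d n) t m in (t', g) :: visits t' s'
  else [::].

Definition layer (s : seq (torus d n * marks)) (i : 'I_6) : {set torus d n} :=
  [set t | has (fun p : torus d n * marks => (p.1 == t) && (i \in p.2)) s].

Definition start (m : nat) : torus d n :=
  iter m (fun t => tact t (i0, true)) (emb x).

Definition approx_of_layers (F : 'I_6 -> {set torus d n}) : {set torus d n} :=
  approx (@tact d n) (@tev d n) d h (F (inord 3))
    (majority (N2 (@tact d n)) q (F (inord 0)) (F (inord 1)) (F (inord 2)))
    (F (inord 4)) (F (inord 5)).

Definition decode (c : code) : {set vertex d n} :=
  let F := layer (visits (start c.1) c.2) in
  [set v | emb v \in approx_of_layers F].

Lemma card_code : #|code| = (L.+1 * (((2 * d).+1 ^ 18) * 2 ^ 6) ^ (2 * K))%N.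
Proof.
rewrite card_prod card_ord card_tuple card_prod card_tuple card_option card_dir.
by rewrite -[#|marks|]cardsT -powersetT card_powerset cardsT card_ord.
Qed.

Lemma visits_path (g : torus d n -> marks) t p : path (near (@tact d n) 18) t p ->
  exists2 s, size s = size p & visits t s = [seq (y, g y) | y <- p].
Proof.
elim: p t => [|y p IH] t /=; first by exists [::].
move=> /andP[/existsP[m /eqP ty] /IH[s sp sE]].
by exists ((m, g y) :: s); rewrite /= ?sp // ty sE.
Qed.

Lemma layers_coded (X : {set torus d n}) (F : 'I_6 -> {set torus d n}) m :
    m <= L -> start m \in X -> #|X| <= K -> (forall i, F i \subset X) ->
    (forall C : {set torus d n}, C \proper X -> start m \in C ->
       exists c y, [/\ c \in C, y \in X :\: C & near (@tact d n) 18 c y]) ->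
  exists c : code, layer (visits (start c.1) c.2) =1 F.
Proof.
move=> mL uX XK FX conn.
have [p [pp sp pX]] := spanning_walk (near_sym (@tactK d n) 18) uX conn.
have X0 : 0 < #|X| by apply/card_gt0P; exists (start m).
pose pad := 2 * K - (size p).+1.
(* [visits] records only the ends of jumps, so the walk begins with a jump from the start to itself;
   the padding gives all codes length 2K. *)
pose p' := start m :: p ++ nseq pad (last (start m) p).
have pp' : path (near (@tact d n) 18) (start m) p'.
  rewrite /p' /= near_refl /= cat_path pp /=.
  by elim: (pad) => //= k ->; rewrite near_refl.
have sp' : size p' = (2 * K)%N.
  by rewrite /p' /= size_cat size_nseq /pad sp; move: X0 XK; set a := #|X|; clearbody a; clear; lia.
have p'X y : (y \in p') = (y \in X).
  rewrite -pX /p' !inE mem_cat mem_nseq.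
  have [->|] := eqVneq y (last (start m) p); last by rewrite !andbF !orbF.
  rewrite andbT; have := mem_last (start m) p; rewrite inE.
  by case: (_ == _) => //= ->.
have [s ss sE] := visits_path (fun y => [set i | y \in F i]) pp'.
have ss' : size s == (2 * K)%N by rewrite ss sp'.
exists (Ordinal (mL : m < L.+1), Tuple ss') => i.
apply/setP => t; rewrite in_set /= sE has_map; apply/hasP/idP => /=.
  by move=> [y _ /andP[/eqP <-]]; rewrite in_set.
by move=> tF; exists t; rewrite ?p'X ?(subsetP (FX i)) // eqxx in_set.
Qed.
End Coding.

(** * From a cutset to its code *)

Section CutCode.
Variables (R : realType) (d n : nat) (x : vertex d n) (i0 : 'I_d).
Variables (G : {set {set vertex d n}}) (eps : R) (k0 h c t : nat).
Hypotheses (n_gt0 : 0 < n) (d_big : 600 <= d) (x_even : even_vertex x).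
Hypotheses (k0_d : k0 ^ 2 <= d < k0.+1 ^ 2) (h_gt0 : 0 < h) (h_k0 : 2 * h <= k0.+1).
Hypotheses (c_big : 1000 <= c) (t_gt0 : 0 < t) (dt : d <= 2 ^ t) (td : 2 ^ t <= d ^ 2).
Hypothesis c_d : (32 * c%:R * ln d%:R <= d%:R ^+ 2 :> R)%R.
Hypothesis eps_lb : (k0%:R <= d%:R * eps)%R.
Hypothesis GE : OMCut_eps eps x G.

Notation inner' := (inner x G).
Notation touts := (outs (@tact d n) (@tev d n) inner').
Notation near' := (near (@tact d n)).

Lemma coded_data : d ^ 2 <= 4 * #|G| /\
  exists X : {set torus d n}, exists F : 'I_6 -> {set torus d n}, exists m : nat,
  [/\ [/\ m <= #|G|, start x i0 m \in X, (forall i, F i \subset X) &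
        (forall C : {set torus d n}, C \proper X -> start x i0 m \in C ->
          exists c y, [/\ c \in C, y \in X :\: C & near' 18 c y])],
      interior_approximation R x G
        [set v | emb v \in approx_of_layers (5 * t) h F] &
      exists s0 sY sW sZ sC, [/\ #|X| <= s0 + sY + sW + sZ + sC + 1,
        (s0%:R <= 32 * c%:R * ln d%:R / d%:R ^+ 2 * #|G|%:R +
           2 * (4 * d%:R ^+ 2 * #|G|%:R) / d%:R ^+ 4 :> R)%R,
        sY * (h * d) <= #|cut_r R x G| /\
        sW * (h * d) <= (t + 2) * (2304 * (c * #|cut_r R x G|)),
        sZ * (d.-1 * k0) <= (8 + 768 * c) * #|cut_r R x G| &
        sC * d ^ 2 <= 4 * #|G|]].
Proof.
case: GE => -[MC odd_cut] lb _.
have d1 : 1 < d by apply: leq_trans d_big.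
have d0 : 0 < d by apply: ltnW.
have [k0d dk0] := andP k0_d.
have evA : forall (t : torus d n) k, t \in inner' -> tev t -> tact t k \in inner'.
  by move=> y k; apply: inner_even.
have rM : \sum_(v in rough (@tact d n) (@tev d n) inner' k0)
    deg (@tact d n) v (~: inner') <= #|cut_r R x G|.
  by rewrite (rough_sum n_gt0 MC odd_cut R k0_d).
have sL := degL n_gt0 MC odd_cut.
have kL : k0 * #|G| <= d * #|cut_r R x G|.
  rewrite -(ler_nat R) !natrM; apply: le_trans (_ : d%:R * eps * #|G|%:R <= _)%R.
    by rewrite ler_wpM2r ?ler0n.
  by rewrite -mulrA ler_wpM2l ?ler0n // ltW.
have oin := @inner_odd d n x G x_even.
have oex := @outs_exit d n x G MC.
have blb (S : {set torus d n}) : S \subset inner' :|: touts -> d < #|S| ->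
    d.-1 * k0 <= \sum_(y in S) deg (@tact d n) y (~: S).
  move=> SA dS; apply: boundary_lower_bound => //; last first.
    by apply: leq_trans k0d _; apply: ltnW.
  move=> y i /(subsetP SA) /setUP[yA|yO]; first exact: inner_max yA i.
  exact: (outs_max MC yO).
have [m mL mO] := ray_hits_outs n_gt0 d1 MC odd_cut i0 x_even.
split.
  have Llow := (L_lower (card_dir d) (@tactC d n) (@tactK d n) (@toppK d) (tact_inj n_gt0)
    (@tev_act d n) evA d_big k0d h_k0 rM sL kL oin oex).
  by apply: Llow; apply/set0Pn; exists (start x i0 m).
have [S0 [S1 [S2 [SY [SW [Z [S]]]]]]] := local_data (card_dir d) (@tactC d n)
  (@tactK d n) (@toppK d) (tact_inj n_gt0) (@tev_act d n) (@card_common d n n_gt0) evA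
  d_big k0d h_k0 rM sL kL oin oex blb c_big h_gt0 t_gt0 dt td c_d.
move=> [[roughE0 EA subc net] [s012 sY sW sZ sC]].
pose F (i : 'I_6) := nth set0 [:: S0; S1; S2; SY; SW; Z] i.
pose X := S0 :|: S1 :|: S2 :|: SY :|: SW :|: Z :|: S :|: [set start x i0 m].
exists X, F, m; split; first split=> //.
- by rewrite !inE eqxx orbT.
- move=> i; rewrite /F; apply/subsetP => y; case: i => [] [|[|[|[|[|[|i]]]]]] //= _ yS;
    by rewrite !inE yS ?orbT.
- move=> C /properP[CX [y0 y0X y0C]] uC.
  have XO y : y \in X -> exists2 e, e \in touts & near' 2 e y.
    rewrite in_setU => /orP[/(subsetP subc)|].
      by rewrite in_set => /existsP[e /andP[eO ey]]; exists e.
    by rewrite in_set1 => /eqP->; exists (start x i0 m); rewrite ?near_refl.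
  have SX s : s \in S -> s \in X by move=> sS; rewrite !inE sS ?orbT.
  have nsym k := near_sym (@tactK d n) k.
  suff : [exists a, exists b, [&& a \in C, b \in X :\: C & near' 18 a b]].
    by move=> /existsP[a /existsP[b /and3P[? ? ?]]]; exists a, b.
  apply: contraT => /existsPn nE.
  have far a b : a \in C -> b \in X -> near' 18 a b -> b \in C.
    move=> aC bX ab; have /existsPn/(_ b) := nE a.
    by rewrite aC ab andbT in_setD bX andbT negbK.
  (* If no jump left [C] inside [X], then [C'], the 8-neighbourhood of [C], would be closed under
     distance 2 within O, against [outs_connected]: the net point near the next vertex of O would
     already be in [C]. *)
  pose C' := [set e | [exists a in C, near' 8 a e]].
  have C'P e : reflect (exists2 a, a \in C & near' 8 a e) (e \in C').
    by rewrite in_set; apply: (iffP exists_inP).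
  have [e0 e0O e0y] := XO y0 y0X.
  have e0C : e0 \notin C'.
    apply: contra y0C => /C'P[a aC ae]; apply: (far a) => //.
    by apply: (@near_le _ _ _ (8 + 2)) => //; apply: near_trans ae e0y.
  have uC' : start x i0 m \in C'.
    by apply/C'P; exists (start x i0 m); rewrite ?near_refl.
  have [t1 [t2 [t1O /C'P[a aC at1] t2O t2C t12]]] :=
    outs_connected d1 MC odd_cut mO uC' e0O e0C.
  have [s sS st2] := net t2 t2O.
  case/negP: t2C; apply/C'P; exists s => //; apply: (far a) => //; first exact: SX.
  rewrite -[18]/(8 + 2 + 8); apply: near_trans (near_trans at1 t12) _.
  by rewrite nsym.
- have EF : approx_of_layers (5 * t) h F = approx (@tact d n) (@tev d n) d h SY
      (majority (N2 (@tact d n)) (5 * t) S0 S1 S2) SW Z.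
    by rewrite /approx_of_layers /F !inordK.
  rewrite EF; split; apply/subsetP => v.
    move=> vE; rewrite in_set; apply: (subsetP roughE0).
    by rewrite (roughE n_gt0 MC odd_cut R k0_d) imset_f.
  by rewrite in_set => /(subsetP EA); rewrite mem_inner.
- exists (#|S0| + #|S1| + #|S2|), #|SY|, #|SW|, #|Z|, #|S|; split=> //.
    have U (A B : {set torus d n}) : #|A :|: B| <= #|A| + #|B|.
      exact: (leq_card_setU A B).1.
    rewrite /X; apply: leq_trans (U _ _) _; rewrite cards1 leq_add2r.
    by do 6! (apply: leq_trans (U _ _) _; rewrite leq_add2r).
  by rewrite !natrD.
Qed.

End CutCode.

(** * Estimates *)

Local Open Scope ring_scope.

Lemma nat_sqrt (d : nat) : exists k, (k ^ 2 <= d < k.+1 ^ 2)%N.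
Proof.
have ex : exists k, (k ^ 2 <= d)%N by exists 0%N.
have bd k : (k ^ 2 <= d)%N -> (k <= d)%N by case: k => // k; apply: leq_trans; rewrite leq_pmulr.
have [k kd kmax] := ex_maxnP ex bd; exists k; rewrite kd ltnNge; apply/negP.
by move/kmax; rewrite ltnn.
Qed.

Lemma ln2_ge (R : realType) : 2^-1 <= ln 2 :> R.
Proof.
rewrite -ler_expR lnK ?posrE // -[2^-1]opprK expRN -[leRHS]invrK.
rewrite lef_pV2 ?posrE ?expR_gt0 ?invr_gt0 //.
by apply: le_trans (expR_ge1Dx _); lra.
Qed.

Lemma ln_nat_ge1 (R : realType) (d : nat) : (4 <= d)%N -> 1 <= ln d%:R :> R.
Proof.
move=> d4; apply: le_trans (_ : ln (2 * 2) <= _).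
  by rewrite lnM ?posrE //; have := ln2_ge R; lra.
by rewrite -natrM ler_ln ?posrE ?ltr0n ?ler_nat //; apply: leq_trans d4.
Qed.

Lemma binary_scale (R : realType) (d : nat) : (4 <= d)%N ->
  exists t, [/\ (0 < t)%N, (d <= 2 ^ t)%N, (2 ^ t <= d ^ 2)%N &
    t%:R <= 3 * ln d%:R :> R].
Proof.
move=> d4; have /andP[lo hi] := up_log_bounds (isT : (1 < 2)%N) (leq_trans (isT : 1 < 4)%N d4).
set t := up_log 2 d in lo hi; have t0 : (0 < t)%N.
  by rewrite lt0n; apply: contraTneq d4 => t0; move: hi; rewrite t0; lia.
exists t; split=> //.
  rewrite -(prednK t0) expnS; apply: leq_trans (_ : 2 * d <= _)%N; first lia.
  by rewrite -mulnn leq_mul2r; lia.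
have : (t.-1)%:R * ln 2 <= ln d%:R :> R.
  rewrite mulr_natl -lnXn // -natrX ler_ln ?posrE ?ltr0n ?expn_gt0 ?ler_nat //; lia.
have := ln2_ge R; have := ln_nat_ge1 R d4.
have -> : (t.-1)%:R = t%:R - 1 :> R by rewrite -[in RHS](prednK t0) -natr1 addrK.
have := ler0n R t.-1; rewrite -{1}[t.-1%:R]opprK; have := ler0n R t; nra.
Qed.

Lemma ler_of_mul_le (F : realFieldType) (s b B u : F) :
  0 < b -> s * b <= u -> u <= B * b -> s <= B.
Proof. by move=> b0 su uB; rewrite -(ler_pM2r b0) (le_trans su). Qed.

(* [a = L/d^2] and [y = eps * L / d^(3/2)] measure the cutset; every piece of
   the data is of order at most [y * ln d]. *)
Lemma data_size (F : realFieldType) (c p q D r l e a y L M h k t s0 sY sW sZ sC : F) :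
  100 <= c -> 0 <= p -> p <= 3 * c -> 0 <= q -> q <= c ->
  2 <= r -> D = r ^+ 2 -> 1 <= l -> 1 <= e * r -> L = a * D ^+ 2 ->
  1 <= 4 * a -> y = e * r * a -> M <= 2 * e * L ->
  r <= 4 * h -> r <= 2 * k -> t + 2 <= 5 * l -> 0 <= sY -> 0 <= sW -> 0 <= sZ ->
  s0 <= 32 * c * l / D ^+ 2 * L + 2 * (4 * D ^+ 2 * L) / D ^+ 4 ->
  sY * (h * D) <= M -> sW * (h * D) <= (t + 2) * (p * (c * M)) ->
  sZ * ((D - 1) * k) <= (8 + q * c) * M -> sC * D ^+ 2 <= 4 * L ->
  0 <= M ->
  s0 + sY + sW + sZ + sC + 1 <= 200 * c * c * (y * l).
Proof.
move=> c0 p0 pc q0 qc r2 DE l1 er LE a0 yE ML hr kr t5 sY0 sW0 sZ0 s0b sYb sWb sZb sCb M0.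
have r0 : 0 < r by lra.
have D0 : 0 < D by rewrite DE exprn_gt0.
have ay : a <= y by rewrite yE; nra.
have My : M <= 2 * y * (D * r).
  suff -> : 2 * y * (D * r) = 2 * e * L by [].
  by rewrite yE LE DE; ring.
have Dr0 : 0 < D * r by rewrite mulr_gt0.
have hD : D * r <= 4 * (h * D) by nra.
have y0 : 0 < y by lra.
have sY8 : sY <= 8 * y.
  apply: (@ler_of_mul_le _ _ (D * r) _ (4 * M)) => //; last by nra.
  by apply: le_trans (_ : sY * (4 * (h * D)) <= _); [exact: ler_wpM2l | lra].
have sW8 : sW <= 40 * (p * (c * (y * l))).
  apply: (@ler_of_mul_le _ _ (D * r) _ (4 * (5 * l * (p * (c * (2 * y * (D * r))))))) => //; last first.
    by rewrite le_eqVlt; apply/orP; left; apply/eqP; ring.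
  apply: le_trans (_ : sW * (4 * (h * D)) <= _); first exact: ler_wpM2l.
  have : (t + 2) * (p * (c * M)) <= 5 * l * (p * (c * (2 * y * (D * r)))).
    have cM : c * M <= c * (2 * y * (D * r)) by rewrite ler_pM2l //; lra.
    have cM0 : 0 <= c * M by rewrite mulr_ge0 //; lra.
    apply: le_trans (_ : 5 * l * (p * (c * M)) <= _).
      by rewrite ler_wpM2r // mulr_ge0.
    by rewrite !ler_wpM2l //; lra.
  by lra.
have sZ8 : sZ <= 8 * (8 + q * c) * y.
  apply: (@ler_of_mul_le _ _ (D * r) _ (4 * ((8 + q * c) * (2 * y * (D * r))))) => //; last first.
    by rewrite le_eqVlt; apply/orP; left; apply/eqP; ring.
  apply: le_trans (_ : sZ * (4 * ((D - 1) * k)) <= _).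
    apply: ler_wpM2l => //.
    have D2 : D <= 2 * (D - 1) by nra.
    by apply: le_trans (_ : 2 * (D - 1) * (2 * k) <= _); [apply: ler_pM; lra | lra].
  have : (8 + q * c) * M <= (8 + q * c) * (2 * y * (D * r)).
    by rewrite ler_wpM2l // addr_ge0 // mulr_ge0 //; lra.
  by lra.
have sC4 : sC <= 4 * y.
  apply: (@ler_of_mul_le _ _ (D ^+ 2) _ (4 * L)) => //; first exact: exprn_gt0.
  by rewrite LE mulrA ler_pM2r ?exprn_gt0 //; lra.
have s04 : s0 <= 32 * c * (y * l) + 8 * y.
  apply: le_trans s0b _.
  have -> : 32 * c * l / D ^+ 2 * L + 2 * (4 * D ^+ 2 * L) / D ^+ 4 =
     32 * c * (a * l) + 8 * a.
    by rewrite LE; field; rewrite gt_eqF.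
  have : c * (a * l) <= c * (y * l).
    by rewrite ler_pM2l ?ler_wpM2r //; lra.
  by lra.
have yl : y <= y * l by nra.
have z0 : 0 < y * l by nra.
have cz : c * y <= c * (y * l) by rewrite ler_pM2l //; lra.
have cz2 : 100 * (c * (y * l)) <= c * (c * (y * l)).
  by rewrite ler_wpM2r // mulr_ge0 //; lra.
have cz3 : 100 * (y * l) <= c * (y * l) by rewrite ler_wpM2r //; lra.
have pz : p * (c * (y * l)) <= 3 * (c * (c * (y * l))).
  by rewrite [leRHS]mulrA ler_wpM2r // mulr_ge0 //; lra.
have qy : q * c * y <= c * (c * (y * l)).
  apply: le_trans (_ : c * c * y <= _); last by rewrite -mulrA !ler_pM2l //; lra.
  by rewrite !ler_wpM2r //; lra.
clear - s04 sY8 sW8 sZ8 sC4 ay a0 yl z0 cz cz2 cz3 pz qy; lra.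
Qed.

Lemma powR_half (R : realType) (a : R) : 0 <= a -> a `^ (1 / 2) = Num.sqrt a.
Proof. by move=> a0; rewrite div1r powR12_sqrt. Qed.

Lemma powR_three_halves (R : realType) (a : R) : 0 < a -> a `^ (3 / 2) = a * Num.sqrt a.
Proof.
move=> a0; have -> : 3 / 2 = 1 + 1 / 2 :> R by field.
rewrite powRD ?powRr1 ?powR_half ?ltW //.
by rewrite (gt_eqF a0) implybT.
Qed.

(** Since 4a >= 1, L + 1 <= 2 a d^2 is at most exp(10 a l); a jump with its marks has at most d^37
    values. *)
Lemma code_count (R : realType) (d L K : nat) (a l B : R) :
  (600 <= d)%N -> (d ^ 2 <= 4 * L)%N -> l = ln d%:R -> a = L%:R / d%:R ^+ 2 ->
  K%:R <= B ->
  (L.+1 * ((2 * d).+1 ^ 18 * 2 ^ 6) ^ (2 * K))%:R <= expR (10 * a * l + 74 * B * l).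
Proof.
move=> d600 dL lE aE KB.
have d0 : 0 < d%:R :> R by rewrite ltr0n; lia.
have dx0 : 0 < d%:R ^+ 2 :> R by rewrite exprn_gt0.
have l1 : 1 <= l by rewrite lE ln_nat_ge1 //; lia.
have dE : d%:R = expR l by rewrite lE lnK.
have a4 : 1 <= 4 * a.
  rewrite aE mulrA ler_pdivlMr // mul1r -natrX -(natrM _ 4) ler_nat //.
have LE : L%:R = a * expR (2 * l).
  rewrite expRM_natl -dE aE; field; by rewrite gt_eqF.
rewrite natrM expRD; apply: ler_pM => //.
  apply: le_trans (_ : 2 * L%:R <= _).
    by rewrite -natrM ler_nat; move: dL d600; case: (L) => //; lia.
  rewrite LE.
  have a2 : 2 * a <= expR (2 * a) by apply: le_trans (expR_ge1Dx _); lra.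
  rewrite mulrA; apply: le_trans (_ : expR (2 * a) * expR (2 * l) <= _).
    by rewrite ler_wpM2r ?expR_ge0.
  by rewrite -expRD ler_expR; nra.
have base : ((2 * d).+1 ^ 18 * 2 ^ 6)%:R <= expR (37 * l) :> R.
  rewrite expRM_natl -dE -natrX ler_nat.
  apply: leq_trans (_ : (d ^ 2) ^ 18 * d <= _)%N; last by rewrite -expnM -expnSr.
  by apply: leq_mul; [rewrite leq_exp2r //; nia | lia].
rewrite natrX.
apply: le_trans (_ : expR (37 * l) ^+ (2 * K) <= _).
  by rewrite lerXn2r ?nnegrE ?expR_ge0.
rewrite -expRM_natl ler_expR natrM.
have := ler_wpM2r (_ : 0 <= 74 * l) KB; rewrite mulr_ge0 //; last by lra.
by move=> /(_ isT); lra.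
Qed.

Lemma coded_family (d n : nat) (x : vertex d n) (i0 : 'I_d) (q h L K : nat) :
  exists EE : {set {set vertex d n}},
    (#|EE| <= L.+1 * ((2 * d).+1 ^ 18 * 2 ^ 6) ^ (2 * K))%N /\
    forall (X : {set torus d n}) (F : 'I_6 -> {set torus d n}) (m : nat),
      (m <= L)%N -> start x i0 m \in X -> (#|X| <= K)%N ->
      (forall i, F i \subset X) ->
      (forall C : {set torus d n}, C \proper X -> start x i0 m \in C ->
        exists c y, [/\ c \in C, y \in X :\: C & near (@tact d n) 18 c y]) ->
      [set v | emb v \in approx_of_layers q h F] \in EE.
Proof.
exists (@decode d n x i0 q h L K @: [set: code d L K]); split.
  by rewrite -card_code -cardsT leq_imset_card.
move=> X F m mL sX XK FX con.
have [c /funext cF] := layers_coded mL sX XK FX con.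
rewrite -cF; exact: (imset_f (@decode d n x i0 q h L K) (in_setT c)).
Qed.

Lemma natr_le_sqrt (R : realType) (k m : nat) : (k ^ 2 <= m)%N -> k%:R <= Num.sqrt m%:R :> R.
Proof.
move=> km; rewrite -(ger0_norm (ler0n R k)) -sqrtr_sqr ler_wsqrtr //.
by rewrite -natrX ler_nat.
Qed.

Lemma sqrt_le_natr (R : realType) (k m : nat) : (m <= k ^ 2)%N -> Num.sqrt m%:R <= k%:R :> R.
Proof.
move=> km; rewrite -[leRHS](ger0_norm (ler0n R k)) -sqrtr_sqr ler_wsqrtr //.
by rewrite -natrX ler_nat.
Qed.

Lemma exponent_bound (F : realFieldType) (c a y z l : F) :
  0 <= c -> 1 <= l -> a <= y -> 0 <= y -> y <= z ->
  10 * a * l + 74 * (c * (y * l)) * l <= (10 + 74 * c) * z * l ^+ 2.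
Proof.
move=> c0 l1 ay y0 yz; apply: le_trans (_ : (10 + 74 * c) * y * l ^+ 2 <= _).
  have : a * l <= y * l ^+ 2.
    rewrite expr2 mulrA; apply: le_trans (_ : y * l <= _); first by rewrite ler_wpM2r //; lra.
    by rewrite ler_peMr ?mulr_ge0 //; lra.
  by lra.
by rewrite ler_wpM2r ?sqr_ge0 // ler_wpM2l //; lra.
Qed.

Theorem theorem4p9 (R : realType) :
  exists (C : R) (d0 : nat),
  forall (L : int) (d : nat), (d0 <= d)%N ->
  forall eps : R, d%:R `^ (- (1 / 2)) <= eps -> eps <= 1 / 2 ->
  forall n : nat, (2 <= n)%N ->
  forall x : vertex d n, even_vertex x ->
  exists EE : {set {set vertex d n}},
    #|EE|%:R <= expR (C * Num.sqrt eps * ln d%:R ^+ 2 / d%:R `^ (3 / 2) * L%:~R)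
    /\ (forall Gamma : {set {set vertex d n}},
          OMCut_eps eps x Gamma -> #|Gamma|%:Z = L ->
          exists2 E, E \in EE & interior_approximation R x Gamma E).
Proof.
have [c c_big] : exists c, (1000 <= c)%N by exists 1000%N.
set C1 : R := 200 * c%:R * c%:R.
(* [C1] is the constant of [data_size]; d >= 32c keeps the sampling density at most 1. *)
exists (10 + 74 * C1), (32 * c)%N => L d d_big eps eps_lb eps_ub n n2 x x_even.
have n_gt0 : (0 < n)%N by lia.
have d600 : (600 <= d)%N by lia.
(* If there is no such cutset, the empty family works. Otherwise one cutset shows that [L] is a
   natural number with d^2 <= 4L. *)
have [[G [GE GL]]|none] := pselect (exists G, OMCut_eps eps x G /\ #|G|%:Z = L); last first.
  exists set0; rewrite cards0 expR_ge0; split=> // G GE GL.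
  by case: none; exists G.
have [k0 k0_d] := nat_sqrt d.
pose h := k0./2.
have [t [t_gt0 dt td t_ln]] := binary_scale R (leq_trans (isT : (4 <= 600)%N) d600).
set l := ln d%:R : R in t_ln *.
set r := Num.sqrt d%:R : R.
have d0 : 0 < d%:R :> R by rewrite ltr0n; lia.
have l1 : 1 <= l by rewrite ln_nat_ge1 //; lia.
have r0 : 0 < r by rewrite sqrtr_gt0.
have dr : d%:R = r ^+ 2 by rewrite sqr_sqrtr ?ltW.
have r20 : 20 <= r by apply: natr_le_sqrt; lia.
have er : 1 <= eps * r.
  by move: eps_lb; rewrite powRN powR_half ?(ltW d0) // -div1r ler_pdivrMr.
have eps0 : 0 < eps by rewrite -(pmulr_lgt0 _ r0) (lt_le_trans ltr01).
have l0 : 0 < l by rewrite (lt_le_trans ltr01).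
have sqrt_eps : eps <= Num.sqrt eps.
  rewrite -{1}(sqr_sqrtr (ltW eps0)) expr2 ger_pMl ?sqrtr_gt0 //.
  by rewrite -sqrtr1 ler_wsqrtr //; lra.
have t5 : t%:R + 2 <= 5 * l by lra.
have k0_r : k0%:R <= r by apply: natr_le_sqrt; case/andP: k0_d.
have r_k0 : r <= k0%:R + 1 by rewrite natr1 sqrt_le_natr // ltnW //; case/andP: k0_d.
have h_gt0 : (0 < h)%N by rewrite half_gt0 -(ltr_nat R); lra.
have [h_k0 k0_h] : (2 * h <= k0.+1)%N /\ (k0 <= 2 * h + 1)%N.
  by rewrite /h; clear; split; lia.
have r_h : r <= 4 * h%:R.
  by move: k0_h; rewrite -(ler_nat R) natrD natrM; lra.
have r_k : r <= 2 * k0%:R by lra.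
have c_d : 32 * c%:R * ln d%:R <= d%:R ^+ 2 :> R.
  rewrite expr2 ler_pM ?mulr_ge0 -/l //; first lra.
    by rewrite -(natrM _ 32) ler_nat.
  by rewrite -ler_expR lnK // (le_trans _ (expR_ge1Dx _)) // lerDr.
have eps_k0 : k0%:R <= d%:R * eps by rewrite dr; nra.
have i0 : 'I_d by exists 0%N; rewrite -(ltr0n R).
have data := coded_data i0 n_gt0 d600 x_even k0_d h_gt0 h_k0 c_big t_gt0 dt td c_d eps_k0.
have dL : (d ^ 2 <= 4 * #|G|)%N by have [] := data _ GE.
pose a : R := #|G|%:R / d%:R ^+ 2.
pose y := eps * r * a.
pose K := Num.truncn (C1 * (y * l)).
(* The family depends on [G] only through |G| = L, so it serves every cutset of this size. *)
have [EE [EEcard EEP]] := coded_family x i0 (5 * t) h #|G| K.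
have a4 : 1 <= 4 * a.
  by rewrite mulrA ler_pdivlMr ?exprn_gt0 // mul1r -natrX -(natrM _ 4) ler_nat.
have GaE : #|G|%:R = a * d%:R ^+ 2 by rewrite mulfVK // gt_eqF ?exprn_gt0.
have a0 : 0 < a by rewrite -(pmulr_rgt0 _ (_ : 0 < 4)) // (lt_le_trans ltr01).
have y0 : 0 < y := mulr_gt0 (mulr_gt0 eps0 r0) a0.
have C10 : 0 <= C1 := mulr_ge0 (mulr_ge0 (ler0n _ 200) (ler0n _ c)) (ler0n _ c).
have B0 : 0 <= C1 * (y * l) := mulr_ge0 C10 (mulr_ge0 (ltW y0) (ltW l0)).
exists EE; split.
  have KB : K%:R <= C1 * (y * l) by rewrite truncn_le.
  have := code_count d600 dL erefl erefl KB.
  move/(le_trans (_ : #|EE|%:R <= _)); rewrite ler_nat => /(_ EEcard) /le_trans; apply.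
  rewrite ler_expR powR_three_halves // -GL -pmulrn GaE -/l -/r -/a.
  have -> : (10 + 74 * C1) * Num.sqrt eps * l ^+ 2 / (d%:R * r) * (a * d%:R ^+ 2) =
      (10 + 74 * C1) * (Num.sqrt eps * r * a) * l ^+ 2.
    by rewrite dr; field; rewrite gt_eqF.
  have ay : a <= y by rewrite /y ler_peMl // ltW.
  have ys : y <= Num.sqrt eps * r * a.
    rewrite (ler_wpM2r (ltW a0)) // (ler_wpM2r (ltW r0)) //.
  by apply: exponent_bound; rewrite // ?(ltW y0) // mulfK // gt_eqF ?exprn_gt0.
move=> G' GE' GL'; have eG : #|G'| = #|G| by move: GL'; rewrite -GL => -[].
have [_ [X [F [m [[mG sX FX con] approxE sizes]]]]] := data _ GE'.
exists [set v | emb v \in approx_of_layers (5 * t) h F] => //.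
apply: (EEP X F m) => //; first by rewrite -eG.
have [s0 [sY [sW [sZ [sC [Xs s0b [sYb sWb] sZb sCb]]]]]] := sizes.
rewrite truncn_ge_nat //.
apply: le_trans (_ : (s0 + sY + sW + sZ + sC + 1)%:R <= _); first by rewrite ler_nat.
rewrite !natrD.
have [_ _ M2] := GE'.
apply: (@data_size _ c%:R 2304%:R 768%:R d%:R r l eps a y #|G|%:R
  #|cut_r R x G'|%:R h%:R k0%:R t%:R); rewrite ?ler0n //.
- by rewrite (ler_nat _ 100) (leq_trans _ c_big).
- by rewrite -(natrM _ 3) ler_nat (leq_trans (_ : _ <= 3 * 1000)%N) // leq_mul2l.
- by rewrite ler_nat (leq_trans _ c_big).
- by rewrite (le_trans _ r20) // ler_nat.
- by rewrite -eG.
- by rewrite -eG.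
- by rewrite -!natrM ler_nat.
- by rewrite -(natrD _ t 2) -!natrM ler_nat.
- have -> : d%:R - 1 = d.-1%:R :> R.
    by rewrite -[in LHS](prednK (_ : 0 < d)%N) ?(leq_trans _ d600) // -natr1 addrK.
  by rewrite -!natrM -natrD -!natrM ler_nat.
- by rewrite -natrX -!natrM -eG ler_nat.
Qed.
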